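(* Let $M,M'$ be networks of the calculus CaIT and $\omega\in\{\tau,a,\sigma\}$ ($a$ an actuator). Then (1) $M\xrightarrow{\omega}M'$ implies $M\to_\omega M'$; and (2) $M\to_\omega M'$ implies that there is $M''$ with $M\xrightarrow{\omega}M''$ and $M''\equiv M'$.
   Context: The calculus CaIT. Fix a set of locations with a distance $d(h,k)\in\mathbb N$ between locations, a constant $\delta\in\mathbb N$, and a function $\mathrm{rng}$ giving each channel $c$ a range $\mathrm{rng}(c)\in\mathbb N\cup\{-1,\infty\}$. Values $v,w$ include basic values, sensor/actuator values and locations; boolean guards $b$ are decidable. Processes: $P,Q::=\mathsf{nil}\mid \rho.P\mid P\parallel Q\mid \lfloor\pi.P\rfloor Q\mid [b]P;Q\mid X\mid \mathsf{fix}\,X.P$ with $\rho\in\{\sigma,\ @(x),\ s?(x),\ a!v\}$ ($s$ a sensor, $a$ an actuator) and $\pi\in\{\overline{c}\langle v\rangle,\ c(x)\}$. The variable $x$ is bound in $c(x).P$, $s?(x).P$, $@(x).P$ and $X$ in $\mathsf{fix}X.P$; in $\sigma.Q$ and $\lfloor\pi.P\rfloor Q$ the occurrence of $Q$ is time-guarded, and in $\mathsf{fix}X.P$ all occurrences of $X$ must be time-guarded. Networks: $M,N::=\mathbf 0\mid n[\mathcal I\bowtie P]^{\mu}_{h}\mid M\mid N\mid (\nu c)M$, where $n$ is a node name, $\mathcal I$ a partial map from sensor and actuator names to values (physical interface), $\mu\in\{\mathsf s,\mathsf m\}$ (stationary/mobile) and $h$ a location. Sensors are node-dependent or location-dependent.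 Networks are closed and well-formed: node names are distinct; distinct nodes have distinct actuators and distinct node-dependent sensors; if $P$ in $n[\mathcal I\bowtie P]^\mu_h$ contains $s?(x)$ (resp. $a!v$) then $\mathcal I(s)$ (resp. $\mathcal I(a)$) is defined; a node whose interface defines a location-dependent sensor is stationary. $\prod$ denotes iterated parallel composition, with empty product $\mathsf{nil}$ or $\mathbf 0$; $T\{v/x\}$ is substitution. Structural congruence $\equiv$ is the least congruence with: $\parallel$ commutative, associative, unit $\mathsf{nil}$; $[b]P;Q\equiv P$ if $b$ true, $\equiv Q$ if $b$ false; $\mathsf{fix}X.P\equiv P\{\mathsf{fix}X.P/X\}$; $P\equiv Q$ implies $n[\mathcal I\bowtie P]^\mu_h\equiv n[\mathcal I\bowtie Q]^\mu_h$; network $\mid$ commutative, associative, unit $\mathbf 0$; $(\nu c)\mathbf 0\equiv\mathbf 0$; $(\nu c)(\nu d)M\equiv(\nu d)(\nu c)M$; $(\nu c)(M\mid N)\equiv M\mid(\nu c)N$ if $c$ not in $M$. Reduction relations $\to_\tau$, $\to_a$ ($a$ an actuator), $\to_\sigma$ are the least relations closed under: (pos) $n[\mathcal I\bowtie @(x).P]^\mu_h\to_\tau n[\mathcal I\bowtie P\{h/x\}]^\mu_h$; (sensread) if $\mathcal I(s)=v$, $n[\mathcal I\bowtie s?(x).P]^\mu_h\to_\tau n[\mathcal I\bowtie P\{v/x\}]^\mu_h$; (actunchg) if $\mathcal I(a)=v$, $n[\mathcal I\bowtie a!v.P]^\mu_h\to_\tau n[\mathcal I\bowtie P]^\mu_h$;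 (actchg) if $\mathcal I(a)\ne v$, $n[\mathcal I\bowtie a!v.P]^\mu_h\to_a n[\mathcal I[a\mapsto v]\bowtie P]^\mu_h$; (loccom) if $\mathrm{rng}(c)=-1$, $n[\mathcal I\bowtie \lfloor\overline c\langle v\rangle.P\rfloor R\parallel\lfloor c(x).Q\rfloor S]^\mu_h\to_\tau n[\mathcal I\bowtie P\parallel Q\{v/x\}]^\mu_h$; (timestat) if $N=n[\mathcal I\bowtie \prod_i\lfloor\pi_i.P_i\rfloor Q_i\parallel\prod_j\sigma.R_j]^{\mathsf s}_h$ has no $\to_\tau$ reduction then $N\to_\sigma n[\mathcal I\bowtie\prod_iQ_i\parallel\prod_jR_j]^{\mathsf s}_h$; (timemob) likewise for $\mu=\mathsf m$, with result located at any $k$ with $d(h,k)\le\delta$; (glbcom) if $d(h,k)\le\mathrm{rng}(c)$, $n[\mathcal I\bowtie\lfloor\overline c\langle v\rangle.P\rfloor R]^{\mu_1}_h\mid m[\mathcal J\bowtie\lfloor c(x).Q\rfloor S]^{\mu_2}_k\to_\tau n[\mathcal I\bowtie P]^{\mu_1}_h\mid m[\mathcal J\bowtie Q\{v/x\}]^{\mu_2}_k$; (parp) for $\omega\in\{\tau,a\}$, if $\prod_i n_i[\mathcal I_i\bowtie P_i]^{\mu_i}_{h_i}\to_\omega\prod_i n_i[\mathcal I'_i\bowtie P'_i]^{\mu'_i}_{h'_i}$ then $\prod_i n_i[\mathcal I_i\bowtie P_i\parallel Q_i]^{\mu_i}_{h_i}\to_\omega\prod_i n_i[\mathcal I'_i\bowtie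 P'_i\parallel Q_i]^{\mu'_i}_{h'_i}$; (parn) for $\omega\in\{\tau,a\}$, $M\to_\omega M'$ implies $M\mid N\to_\omega M'\mid N$; (timepar) $M\to_\sigma M'$, $N\to_\sigma N'$ and $M\mid N$ has no $\to_\tau$ reduction imply $M\mid N\to_\sigma M'\mid N'$; (timezero) $\mathbf 0\to_\sigma\mathbf 0$; (res) $M\to_\omega N$ implies $(\nu c)M\to_\omega(\nu c)N$ for $\omega\in\{\tau,a,\sigma\}$; (struct) $M\equiv N\to_\omega N'\equiv M'$ implies $M\to_\omega M'$. Labelled (intensional) semantics. Process transitions $P\xrightarrow{\lambda}P'$, $\lambda\in\{\sigma,\tau,\overline cv,cv,@h,s?v,a!v\}$, with $[b]P;Q$ identified with $P$ if $b$ is true and with $Q$ otherwise, are the least relation closed under: $\lfloor\overline c\langle v\rangle.P\rfloor Q\xrightarrow{\overline cv}P$; $\lfloor c(x).P\rfloor Q\xrightarrow{cv}P\{v/x\}$ (any $v$); $s?(x).P\xrightarrow{s?v}P\{v/x\}$ (any $v$); $a!v.P\xrightarrow{a!v}P$; $@(x).P\xrightarrow{@h}P\{h/x\}$ (any $h$); if $P\xrightarrow{\overline cv}P'$, $Q\xrightarrow{cv}Q'$ and $\mathrm{rng}(c)=-1$ then $P\parallel Q\xrightarrow{\tau}P'\parallel Q'$ and $Q\parallel P\xrightarrow{\tau}Q'\parallel P'$; if $P\xrightarrow{\lambda}P'$ with $\lambda\ne\sigma$ then $P\parallel Q\xrightarrow{\lambda}P'\parallel Q$ and $Q\parallel P\xrightarrow{\lambda}Q\parallel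 P'$; if $P\{\mathsf{fix}X.P/X\}\xrightarrow{\lambda}Q$ then $\mathsf{fix}X.P\xrightarrow{\lambda}Q$; $\mathsf{nil}\xrightarrow{\sigma}\mathsf{nil}$; $\sigma.P\xrightarrow{\sigma}P$; $\lfloor\pi.P\rfloor Q\xrightarrow{\sigma}Q$; if $P\xrightarrow{\sigma}P'$, $Q\xrightarrow{\sigma}Q'$ and $P\parallel Q$ has no $\tau$-transition then $P\parallel Q\xrightarrow{\sigma}P'\parallel Q'$. Network transitions $M\xrightarrow{\nu}M'$, $\nu\in\{\sigma,\tau,a,\overline cv@h,cv@h\}$, are the least relation closed under (for a node $n[\mathcal I\bowtie P]^\mu_h$): if $P\xrightarrow{@h}P'$ then node $\xrightarrow{\tau}n[\mathcal I\bowtie P']^\mu_h$; if $\mathcal I(s)=v$ and $P\xrightarrow{s?v}P'$ then node $\xrightarrow{\tau}n[\mathcal I\bowtie P']^\mu_h$; if $\mathcal I(a)=v$ and $P\xrightarrow{a!v}P'$ then node $\xrightarrow{\tau}n[\mathcal I\bowtie P']^\mu_h$; if $\mathcal I(a)\ne v$ and $P\xrightarrow{a!v}P'$ then node $\xrightarrow{a}n[\mathcal I[a\mapsto v]\bowtie P']^\mu_h$; if $P\xrightarrow{\tau}P'$ then node $\xrightarrow{\tau}n[\mathcal I\bowtie P']^\mu_h$; if $P\xrightarrow{\sigma}P'$ and the node has no $\tau$-transition then $n[\mathcal I\bowtie P]^{\mathsf s}_h\xrightarrow{\sigma}n[\mathcal I\bowtie P']^{\mathsf s}_h$ and $n[\mathcal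 I\bowtie P]^{\mathsf m}_h\xrightarrow{\sigma}n[\mathcal I\bowtie P']^{\mathsf m}_k$ for every $k$ with $d(h,k)\le\delta$; if $P\xrightarrow{\overline cv}P'$ (resp. $\xrightarrow{cv}$) and $\mathrm{rng}(c)\ge0$ then node $\xrightarrow{\overline cv@h}$ (resp. $\xrightarrow{cv@h}$) $n[\mathcal I\bowtie P']^\mu_h$; if $M\xrightarrow{\overline cv@k}M'$, $N\xrightarrow{cv@h}N'$ and $d(h,k)\le\mathrm{rng}(c)$ then $M\mid N\xrightarrow{\tau}M'\mid N'$ and $N\mid M\xrightarrow{\tau}N'\mid M'$; if $M\xrightarrow{\nu}M'$, $\nu\ne\sigma$, then $M\mid N\xrightarrow{\nu}M'\mid N$ and $N\mid M\xrightarrow{\nu}N\mid M'$; if $M\xrightarrow{\sigma}M'$, $N\xrightarrow{\sigma}N'$ and $M\mid N$ has no $\tau$-transition then $M\mid N\xrightarrow{\sigma}M'\mid N'$; $\mathbf 0\xrightarrow{\sigma}\mathbf 0$; if $M\xrightarrow{\nu}N$ and $\nu$ is not of the form $\overline cv@h$ or $cv@h$ then $(\nu c)M\xrightarrow{\nu}(\nu c)N$.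
   Formalization: Structural congruence also allows renaming of a bound channel to a fresh one of the same range, and every range in use is assumed to have unlimited fresh channels; without this part (1) fails, since a restricted channel clashing with a free one cannot be extruded. *)

(* Defs.v *)
From mathcomp Require Import all_boot.

Set Implicit Arguments.
Unset Strict Implicit.
Unset Printing Implicit Defensive.

(* The range of a channel, an element of N + {-1, oo}; [RLocal] is -1. *)
Inductive range : Type := RLocal | RFin of nat | RInf.

Definition le_range (d : nat) (r : range) : bool :=
  match r with RLocal => false | RFin k => d <= k | RInf => true end.

Record signature := Signature {
  loc : Type;
  dist : loc -> loc -> nat;
  dist_sym : forall h k, dist h k = dist k h;
  delta : nat;
  value : Type;
  vloc : loc -> value;
  vloc_inj : injective vloc;
  (* A guard is a predicate symbol applied to values or variables. *)
  gsym : Type;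
  geval : gsym -> seq value -> bool;
  chan : eqType;
  rng : chan -> range;
  (* Bound channels can always be renamed: alpha-conversion must preserve
     ranges, so fresh channels are needed at every range in use. *)
  chan_fresh : forall (c : chan) (cs : seq chan),
    exists d, d \notin cs /\ rng d = rng c;
  sensor : eqType;
  (* [locdep s]: location-dependent; otherwise [s] is node-dependent. *)
  locdep : pred sensor;
  actuator : eqType;
  nodename : eqType
}.

Inductive mobility : Type := Stationary | Mobile.

Section CaIT.

Context {S : signature}.

(* Value variables and process variables are two independent families of
   de Bruijn indices, so processes are taken up to alpha-conversion. *)
Inductive term : Type := TVal of value S | TVar of nat.

Record guard := Guard { gpred : gsym S; gargs : seq term }.

Inductive prefix : Type :=
  | Sleep
  | Pos
  | Read of sensor S
  | Write of actuator S & term.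

Inductive cprefix : Type :=
  | Out of chan S & term
  | In of chan S.

Inductive proc : Type :=
  | Nil
  | Pre of prefix & proc
  | Par of proc & proc
  | Timeout of cprefix & proc & proc      (* Timeout pi P Q is |_ pi.P _| Q *)
  | Ite of guard & proc & proc
  | PVar of nat
  | Fix of proc.

Definition bnd (r : prefix) : nat :=
  match r with Sleep | Write _ _ => 0 | Pos | Read _ => 1 end.
Definition cbnd (p : cprefix) : nat :=
  match p with Out _ _ => 0 | In _ => 1 end.

Definition map_guard (f : term -> term) (b : guard) : guard :=
  Guard (gpred b) (map f (gargs b)).
Definition map_prefix (f : term -> term) (r : prefix) : prefix :=
  match r with Write a t => Write a (f t) | _ => r end.
Definition map_cprefix (f : term -> term) (p : cprefix) : cprefix :=
  match p with Out c t => Out c (f t) | In c => In c end.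

(* [map_terms f k P] applies [f (k + i)] to the terms of [P] which occur under
   [i] value binders of [P]. *)
Fixpoint map_terms (f : nat -> term -> term) (k : nat) (P : proc) : proc :=
  match P with
  | Nil => Nil
  | Pre r P => Pre (map_prefix (f k) r) (map_terms f (bnd r + k) P)
  | Par P Q => Par (map_terms f k P) (map_terms f k Q)
  | Timeout p P Q =>
      Timeout (map_cprefix (f k) p) (map_terms f (cbnd p + k) P)
              (map_terms f k Q)
  | Ite b P Q => Ite (map_guard (f k) b) (map_terms f k P) (map_terms f k Q)
  | PVar X => PVar X
  | Fix P => Fix (map_terms f k P)
  end.

Fixpoint map_chan (f : chan S -> chan S) (P : proc) : proc :=
  match P with
  | Nil => Nil
  | Pre r P => Pre r (map_chan f P)
  | Par P Q => Par (map_chan f P) (map_chan f Q)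
  | Timeout (Out c t) P Q => Timeout (Out (f c) t) (map_chan f P) (map_chan f Q)
  | Timeout (In c) P Q => Timeout (In (f c)) (map_chan f P) (map_chan f Q)
  | Ite b P Q => Ite b (map_chan f P) (map_chan f Q)
  | PVar X => PVar X
  | Fix P => Fix (map_chan f P)
  end.

Definition shift_term (k : nat) (t : term) : term :=
  match t with
  | TVal v => TVal v
  | TVar i => TVar (if k <= i then i.+1 else i)
  end.

Definition subst_term (v : value S) (k : nat) (t : term) : term :=
  match t with
  | TVal w => TVal w
  | TVar i => if i == k then TVal v else TVar (if k < i then i.-1 else i)
  end.

Definition vshift (P : proc) : proc := map_terms shift_term 0 P.

(* P{v/x}, where x is the value variable 0 of P. *)
Definition vsubst (v : value S) (P : proc) : proc :=
  map_terms (subst_term v) 0 P.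

Fixpoint pshift (k : nat) (P : proc) : proc :=
  match P with
  | Nil => Nil
  | Pre r P => Pre r (pshift k P)
  | Par P Q => Par (pshift k P) (pshift k Q)
  | Timeout p P Q => Timeout p (pshift k P) (pshift k Q)
  | Ite b P Q => Ite b (pshift k P) (pshift k Q)
  | PVar X => PVar (if k <= X then X.+1 else X)
  | Fix P => Fix (pshift k.+1 P)
  end.

Fixpoint psubst (k : nat) (R P : proc) : proc :=
  match P with
  | Nil => Nil
  | Pre r P => Pre r (psubst k (iter (bnd r) vshift R) P)
  | Par P Q => Par (psubst k R P) (psubst k R Q)
  | Timeout p P Q =>
      Timeout p (psubst k (iter (cbnd p) vshift R) P) (psubst k R Q)
  | Ite b P Q => Ite b (psubst k R P) (psubst k R Q)
  | PVar X => if X == k then R else PVar (if k < X then X.-1 else X)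
  | Fix P => Fix (psubst k.+1 (pshift 0 R) P)
  end.

(* P{fix X.P/X}, where X is the process variable 0 of P. *)
Definition unfold_fix (P : proc) : proc := psubst 0 (Fix P) P.

Definition closed_term (n : nat) (t : term) : bool :=
  match t with TVal _ => true | TVar i => i < n end.

(* Value variables are below [n] and process variables below [m]. *)
Fixpoint closed_proc (n m : nat) (P : proc) : bool :=
  match P with
  | Nil => true
  | Pre r P =>
      (if r is Write _ t then closed_term n t else true)
      && closed_proc (bnd r + n) m P
  | Par P Q => closed_proc n m P && closed_proc n m Q
  | Timeout p P Q =>
      [&& (if p is Out _ t then closed_term n t else true),
          closed_proc (cbnd p + n) m P & closed_proc n m Q]
  | Ite b P Q =>
      [&& all (closed_term n) (gargs b), closed_proc n m P & closed_proc n m Q]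
  | PVar X => X < m
  | Fix P => closed_proc n m.+1 P
  end.

Fixpoint time_guarded (X : nat) (P : proc) : bool :=
  match P with
  | Nil => true
  | Pre Sleep _ => true
  | Pre _ P => time_guarded X P
  | Par P Q => time_guarded X P && time_guarded X Q
  | Timeout _ P _ => time_guarded X P
  | Ite _ P Q => time_guarded X P && time_guarded X Q
  | PVar Y => Y != X
  | Fix P => time_guarded X.+1 P
  end.

Fixpoint wf_proc (P : proc) : bool :=
  match P with
  | Nil | PVar _ => true
  | Pre _ P => wf_proc P
  | Par P Q | Timeout _ P Q | Ite _ P Q => wf_proc P && wf_proc Q
  | Fix P => time_guarded 0 P && wf_proc P
  end.

Fixpoint sensors (P : proc) : seq (sensor S) :=
  match P with
  | Nil | PVar _ => [::]
  | Pre (Read s) P => s :: sensors P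
  | Pre _ P | Fix P => sensors P
  | Par P Q | Timeout _ P Q | Ite _ P Q => sensors P ++ sensors Q
  end.

Fixpoint actuators (P : proc) : seq (actuator S) :=
  match P with
  | Nil | PVar _ => [::]
  | Pre (Write a _) P => a :: actuators P
  | Pre _ P | Fix P => actuators P
  | Par P Q | Timeout _ P Q | Ite _ P Q => actuators P ++ actuators Q
  end.

Fixpoint pchans (P : proc) : seq (chan S) :=
  match P with
  | Nil | PVar _ => [::]
  | Pre _ P | Fix P => pchans P
  | Timeout (Out c _) P Q | Timeout (In c) P Q => c :: pchans P ++ pchans Q
  | Par P Q | Ite _ P Q => pchans P ++ pchans Q
  end.

Record iface := Iface {
  isens : sensor S -> option (value S);
  iact : actuator S -> option (value S)
}.

Definition iupd (I : iface) (a : actuator S) (v : value S) : iface :=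
  Iface (isens I) (fun a' => if a' == a then Some v else iact I a').

Inductive net : Type :=
  | Zero
  | Node of nodename S & iface & proc & mobility & loc S
  | NPar of net & net
  | Res of chan S & net.

Fixpoint node_names (M : net) : seq (nodename S) :=
  match M with
  | Zero => [::]
  | Node n _ _ _ _ => [:: n]
  | NPar M N => node_names M ++ node_names N
  | Res _ M => node_names M
  end.

Fixpoint has_node (n : nodename S) (I : iface) (P : proc) (mu : mobility)
    (h : loc S) (M : net) : Prop :=
  match M with
  | Zero => False
  | Node _ _ _ _ _ => M = Node n I P mu h
  | NPar M N => has_node n I P mu h M \/ has_node n I P mu h N
  | Res _ M => has_node n I P mu h M
  end.

Record network (M : net) : Prop := {
  network_names : uniq (node_names M);
  network_actuators : forall n I P mu h m J Q nu k,
    has_node n I P mu h M -> has_node m J Q nu k M -> n <> m ->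
    forall a, iact I a = None \/ iact J a = None;
  network_sensors : forall n I P mu h m J Q nu k,
    has_node n I P mu h M -> has_node m J Q nu k M -> n <> m ->
    forall s, ~~ locdep s -> isens I s = None \/ isens J s = None;
  network_read : forall n I P mu h, has_node n I P mu h M ->
    forall s, s \in sensors P -> isens I s <> None;
  network_write : forall n I P mu h, has_node n I P mu h M ->
    forall a, a \in actuators P -> iact I a <> None;
  network_stationary : forall n I P mu h, has_node n I P mu h M ->
    forall s, locdep s -> isens I s <> None -> mu = Stationary;
  network_closed : forall n I P mu h, has_node n I P mu h M ->
    closed_proc 0 0 P;
  network_guarded : forall n I P mu h, has_node n I P mu h M ->
    wf_proc P
}.

(* Values are never channels, so channels occur only in prefixes. *)
Fixpoint free_chans (M : net) : seq (chan S) :=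
  match M with
  | Zero => [::]
  | Node _ _ P _ _ => pchans P
  | NPar M N => free_chans M ++ free_chans N
  | Res c M => [seq d <- free_chans M | d != c]
  end.

Definition swap (c d e : chan S) : chan S :=
  if e == c then d else if e == d then c else e.

Fixpoint swap_net (c d : chan S) (M : net) : net :=
  match M with
  | Zero => Zero
  | Node n J P mu h => Node n J (map_chan (swap c d) P) mu h
  | NPar M N => NPar (swap_net c d M) (swap_net c d N)
  | Res e M => Res (swap c d e) (swap_net c d M)
  end.

(* Only closed guards have a truth value. *)
Definition guard_is (b : guard) (r : bool) : Prop :=
  exists2 vs : seq (value S), gargs b = map TVal vs & geval (gpred b) vs = r.

Inductive pcong : proc -> proc -> Prop :=
  | pcong_refl P : pcong P P
  | pcong_sym P Q : pcong P Q -> pcong Q P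
  | pcong_trans P Q R : pcong P Q -> pcong Q R -> pcong P R
  | pcong_pre r P P' : pcong P P' -> pcong (Pre r P) (Pre r P')
  | pcong_par P P' Q Q' :
      pcong P P' -> pcong Q Q' -> pcong (Par P Q) (Par P' Q')
  | pcong_timeout p P P' Q Q' :
      pcong P P' -> pcong Q Q' -> pcong (Timeout p P Q) (Timeout p P' Q')
  | pcong_ite b P P' Q Q' :
      pcong P P' -> pcong Q Q' -> pcong (Ite b P Q) (Ite b P' Q')
  | pcong_fix P P' : pcong P P' -> pcong (Fix P) (Fix P')
  | pcong_parC P Q : pcong (Par P Q) (Par Q P)
  | pcong_parA P Q R : pcong (Par (Par P Q) R) (Par P (Par Q R))
  | pcong_par0 P : pcong (Par P Nil) P
  | pcong_true b P Q : guard_is b true -> pcong (Ite b P Q) P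
  | pcong_false b P Q : guard_is b false -> pcong (Ite b P Q) Q
  | pcong_unfold P : pcong (Fix P) (unfold_fix P).

Inductive ncong : net -> net -> Prop :=
  | ncong_refl M : ncong M M
  | ncong_sym M N : ncong M N -> ncong N M
  | ncong_trans M N O : ncong M N -> ncong N O -> ncong M O
  | ncong_node n I P Q mu h :
      pcong P Q -> ncong (Node n I P mu h) (Node n I Q mu h)
  | ncong_par M M' N N' :
      ncong M M' -> ncong N N' -> ncong (NPar M N) (NPar M' N')
  | ncong_res c M M' : ncong M M' -> ncong (Res c M) (Res c M')
  | ncong_parC M N : ncong (NPar M N) (NPar N M)
  | ncong_parA M N O : ncong (NPar (NPar M N) O) (NPar M (NPar N O))
  | ncong_par0 M : ncong (NPar M Zero) M
  | ncong_res0 c : ncong (Res c Zero) Zero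
  | ncong_resC c d M : ncong (Res c (Res d M)) (Res d (Res c M))
  | ncong_extr c M N :
      c \notin free_chans M -> ncong (Res c (NPar M N)) (NPar M (Res c N))
  (* Renaming of a bound channel; networks are considered up to it. *)
  | ncong_alpha c d M :
      d \notin free_chans M -> rng d = rng c ->
      ncong (Res c M) (Res d (swap_net c d M)).

Inductive ilabel : Type := Tau | Act of actuator S.
Inductive label : Type := Inst of ilabel | Sigma.

(* The side conditions of the timed rules are negative but only concern
   tau-steps, whose rules do not involve sigma: the latter come first. *)
Inductive ired : ilabel -> net -> net -> Prop :=
  | ired_pos n I P mu h :
      ired Tau (Node n I (Pre Pos P) mu h) (Node n I (vsubst (vloc h) P) mu h)
  | ired_sensread n I s v P mu h : isens I s = Some v ->
      ired Tau (Node n I (Pre (Read s) P) mu h) (Node n I (vsubst v P) mu h)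
  | ired_actunchg n I a v P mu h : iact I a = Some v ->
      ired Tau (Node n I (Pre (Write a (TVal v)) P) mu h) (Node n I P mu h)
  | ired_actchg n I a v P mu h : iact I a <> Some v ->
      ired (Act a) (Node n I (Pre (Write a (TVal v)) P) mu h)
                   (Node n (iupd I a v) P mu h)
  | ired_loccom n I c v P Q R T mu h : rng c = RLocal ->
      ired Tau
        (Node n I (Par (Timeout (Out c (TVal v)) P R) (Timeout (In c) Q T)) mu h)
        (Node n I (Par P (vsubst v Q)) mu h)
  | ired_glbcom n I m J c v P Q R T mu1 mu2 h k : le_range (dist h k) (rng c) ->
      ired Tau
        (NPar (Node n I (Timeout (Out c (TVal v)) P R) mu1 h)
              (Node m J (Timeout (In c) Q T) mu2 k))
        (NPar (Node n I P mu1 h) (Node m J (vsubst v Q) mu2 k))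
  | ired_parp w p (n : 'I_p -> nodename S) I I' P P' Q mu mu' h h' :
      ired w (\big[NPar/Zero]_(i < p) Node (n i) (I i) (P i) (mu i) (h i))
             (\big[NPar/Zero]_(i < p) Node (n i) (I' i) (P' i) (mu' i) (h' i)) ->
      ired w
        (\big[NPar/Zero]_(i < p)
            Node (n i) (I i) (Par (P i) (Q i)) (mu i) (h i))
        (\big[NPar/Zero]_(i < p)
            Node (n i) (I' i) (Par (P' i) (Q i)) (mu' i) (h' i))
  | ired_parn w M M' N : ired w M M' -> ired w (NPar M N) (NPar M' N)
  | ired_res w c M N : ired w M N -> ired w (Res c M) (Res c N)
  | ired_struct w M N N' M' :
      ncong M N -> ired w N N' -> ncong N' M' -> ired w M M'.

Definition red_stuck (M : net) : Prop := ~ exists M', ired Tau M M'.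

Inductive tred : net -> net -> Prop :=
  | tred_timestat n I h p q (pi : 'I_p -> cprefix) (P Q : 'I_p -> proc)
      (R : 'I_q -> proc) :
      let N := Node n I (Par (\big[Par/Nil]_(i < p) Timeout (pi i) (P i) (Q i))
                             (\big[Par/Nil]_(j < q) Pre Sleep (R j)))
                    Stationary h in
      red_stuck N ->
      tred N (Node n I (Par (\big[Par/Nil]_(i < p) Q i)
                            (\big[Par/Nil]_(j < q) R j)) Stationary h)
  | tred_timemob n I h k p q (pi : 'I_p -> cprefix) (P Q : 'I_p -> proc)
      (R : 'I_q -> proc) :
      let N := Node n I (Par (\big[Par/Nil]_(i < p) Timeout (pi i) (P i) (Q i))
                             (\big[Par/Nil]_(j < q) Pre Sleep (R j)))
                    Mobile h in
      red_stuck N -> dist h k <= delta S ->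
      tred N (Node n I (Par (\big[Par/Nil]_(i < p) Q i)
                            (\big[Par/Nil]_(j < q) R j)) Mobile k)
  | tred_timepar M M' N N' :
      tred M M' -> tred N N' -> red_stuck (NPar M N) ->
      tred (NPar M N) (NPar M' N')
  | tred_timezero : tred Zero Zero
  | tred_res c M N : tred M N -> tred (Res c M) (Res c N)
  | tred_struct M N N' M' : ncong M N -> tred N N' -> ncong N' M' -> tred M M'.

Definition red (w : label) : net -> net -> Prop :=
  match w with Inst u => ired u | Sigma => tred end.

Inductive plabel : Type :=
  | PTau
  | POut of chan S & value S
  | PIn of chan S & value S
  | PPos of loc S
  | PRead of sensor S & value S
  | PWrite of actuator S & value S.

Inductive ptrans : plabel -> proc -> proc -> Prop :=
  | ptrans_out c v P Q : ptrans (POut c v) (Timeout (Out c (TVal v)) P Q) P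
  | ptrans_in c v P Q : ptrans (PIn c v) (Timeout (In c) P Q) (vsubst v P)
  | ptrans_read s v P : ptrans (PRead s v) (Pre (Read s) P) (vsubst v P)
  | ptrans_write a v P : ptrans (PWrite a v) (Pre (Write a (TVal v)) P) P
  | ptrans_pos h P : ptrans (PPos h) (Pre Pos P) (vsubst (vloc h) P)
  | ptrans_coml c v P P' Q Q' :
      ptrans (POut c v) P P' -> ptrans (PIn c v) Q Q' -> rng c = RLocal ->
      ptrans PTau (Par P Q) (Par P' Q')
  | ptrans_comr c v P P' Q Q' :
      ptrans (POut c v) P P' -> ptrans (PIn c v) Q Q' -> rng c = RLocal ->
      ptrans PTau (Par Q P) (Par Q' P')
  | ptrans_parl l P P' Q : ptrans l P P' -> ptrans l (Par P Q) (Par P' Q)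
  | ptrans_parr l P P' Q : ptrans l P P' -> ptrans l (Par Q P) (Par Q P')
  | ptrans_fix l P Q : ptrans l (unfold_fix P) Q -> ptrans l (Fix P) Q
  | ptrans_true l b P Q P' :
      guard_is b true -> ptrans l P P' -> ptrans l (Ite b P Q) P'
  | ptrans_false l b P Q Q' :
      guard_is b false -> ptrans l Q Q' -> ptrans l (Ite b P Q) Q'.

Inductive ptick : proc -> proc -> Prop :=
  | ptick_nil : ptick Nil Nil
  | ptick_sleep P : ptick (Pre Sleep P) P
  | ptick_timeout p P Q : ptick (Timeout p P Q) Q
  | ptick_par P P' Q Q' :
      ptick P P' -> ptick Q Q' -> ~ (exists R, ptrans PTau (Par P Q) R) ->
      ptick (Par P Q) (Par P' Q')
  | ptick_fix P Q : ptick (unfold_fix P) Q -> ptick (Fix P) Q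
  | ptick_true b P Q P' : guard_is b true -> ptick P P' -> ptick (Ite b P Q) P'
  | ptick_false b P Q Q' :
      guard_is b false -> ptick Q Q' -> ptick (Ite b P Q) Q'.

Inductive nlabel : Type :=
  | NInst of ilabel
  | NOut of chan S & value S & loc S
  | NIn of chan S & value S & loc S.

Definition nlabel_chan (l : nlabel) : option (chan S) :=
  match l with NInst _ => None | NOut c _ _ | NIn c _ _ => Some c end.

Inductive itrans : nlabel -> net -> net -> Prop :=
  | itrans_pos n I P P' mu h : ptrans (PPos h) P P' ->
      itrans (NInst Tau) (Node n I P mu h) (Node n I P' mu h)
  | itrans_sensread n I s v P P' mu h :
      isens I s = Some v -> ptrans (PRead s v) P P' ->
      itrans (NInst Tau) (Node n I P mu h) (Node n I P' mu h)
  | itrans_actunchg n I a v P P' mu h :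
      iact I a = Some v -> ptrans (PWrite a v) P P' ->
      itrans (NInst Tau) (Node n I P mu h) (Node n I P' mu h)
  | itrans_actchg n I a v P P' mu h :
      iact I a <> Some v -> ptrans (PWrite a v) P P' ->
      itrans (NInst (Act a)) (Node n I P mu h) (Node n (iupd I a v) P' mu h)
  | itrans_loccom n I P P' mu h : ptrans PTau P P' ->
      itrans (NInst Tau) (Node n I P mu h) (Node n I P' mu h)
  | itrans_out n I c v P P' mu h :
      ptrans (POut c v) P P' -> le_range 0 (rng c) ->
      itrans (NOut c v h) (Node n I P mu h) (Node n I P' mu h)
  | itrans_in n I c v P P' mu h :
      ptrans (PIn c v) P P' -> le_range 0 (rng c) ->
      itrans (NIn c v h) (Node n I P mu h) (Node n I P' mu h)
  | itrans_glbcoml c v h k M M' N N' :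
      itrans (NOut c v k) M M' -> itrans (NIn c v h) N N' ->
      le_range (dist h k) (rng c) ->
      itrans (NInst Tau) (NPar M N) (NPar M' N')
  | itrans_glbcomr c v h k M M' N N' :
      itrans (NOut c v k) M M' -> itrans (NIn c v h) N N' ->
      le_range (dist h k) (rng c) ->
      itrans (NInst Tau) (NPar N M) (NPar N' M')
  | itrans_parl l M M' N : itrans l M M' -> itrans l (NPar M N) (NPar M' N)
  | itrans_parr l M M' N : itrans l M M' -> itrans l (NPar N M) (NPar N M')
  | itrans_res l c M N : itrans l M N -> nlabel_chan l <> Some c ->
      itrans l (Res c M) (Res c N).

Definition trans_stuck (M : net) : Prop :=
  ~ exists M', itrans (NInst Tau) M M'.

Inductive ttrans : net -> net -> Prop :=
  | ttrans_timestat n I P P' h :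
      ptick P P' -> trans_stuck (Node n I P Stationary h) ->
      ttrans (Node n I P Stationary h) (Node n I P' Stationary h)
  | ttrans_timemob n I P P' h k :
      ptick P P' -> trans_stuck (Node n I P Mobile h) -> dist h k <= delta S ->
      ttrans (Node n I P Mobile h) (Node n I P' Mobile k)
  | ttrans_timepar M M' N N' :
      ttrans M M' -> ttrans N N' -> trans_stuck (NPar M N) ->
      ttrans (NPar M N) (NPar M' N')
  | ttrans_timezero : ttrans Zero Zero
  | ttrans_res c M N : ttrans M N -> ttrans (Res c M) (Res c N).

Definition trans (w : label) : net -> net -> Prop :=
  match w with Inst u => itrans (NInst u) | Sigma => ttrans end.

End CaIT.

Arguments term : clear implicits.
Arguments proc : clear implicits.
Arguments net : clear implicits.
Arguments iface : clear implicits.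
Arguments label : clear implicits.

(* Main.v *)
From mathcomp Require Import all_boot.
From Stdlib Require Import Classical.
Require Import Defs.

Set Implicit Arguments.
Unset Strict Implicit.
Unset Printing Implicit Defensive.

(* From transitions to reductions: a process able to perform an action is
   congruent to a redex in parallel with a rest, two communicating networks are
   brought together by extruding restrictions renamed apart, and a process able
   to let time pass is congruent to a product of timeouts and sleeping
   processes. From reductions to transitions: structural congruence is a
   bisimulation for both kinds of steps. Under recursion this is not an
   induction on congruence derivations, since unfolding duplicates the body; the
   congruence is therefore presented as the transitive closure of a parallel
   relation closed under substitution, and one argues by induction on the
   transition first. The rule (parp) is sound because node names are distinct:
   congruent restriction-free networks then match node by node. *)

(** The two semantics must be compared on instantaneous steps before time can be treated, because
    each timed relation carries its own stuckness premise. These premises are exchanged crosswise: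
    turning a timed transition into a timed reduction requires that a network without
    tau-transitions has no tau-reduction, which is where distinct node names enter, while the
    opposite conversion uses that every tau-transition is a tau-reduction. Stuckness also makes the
    bisimulation for time depend on the one for instantaneous steps, since a congruent network must
    be shown stuck too. Communication is restated with a symmetric synchronisation predicate on
    labels, so that sender and receiver can be exchanged freely. Finally, the intermediate network
    of the second claim must itself be well formed. This is read off the transition that leads to
    it, because congruence does not preserve well-formedness: a decided guard may introduce an
    arbitrary discarded branch. *)

(** * De Bruijn calculus: shifts and substitutions of value and process variables *)

Section Substitution.

Context {S : signature}.
Implicit Types (P Q R T : proc S) (f g : nat -> @term S -> @term S).

Lemma bnd_map (f : term S -> term S) r : bnd (map_prefix f r) = bnd r.
Proof. by case: r. Qed.

Lemma cbnd_map (f : term S -> term S) p : cbnd (map_cprefix f p) = cbnd p.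
Proof. by case: p. Qed.

(** The offset [i] in the hypothesis stands for the binders crossed inside [P], so the hypothesis
    reproduces itself under a binder and all commutations of shifts and value substitutions reduce
    to one identity on terms. *)
Lemma map_terms_exchange f g f' g' a b c d P :
  (forall i t, f (i + a) (g (i + b) t) = f' (i + c) (g' (i + d) t)) ->
  map_terms f a (map_terms g b P) = map_terms f' c (map_terms g' d P).
Proof.
elim: P a b c d => //=.
- move=> r P IH a b c d E; rewrite !bnd_map; congr Pre.
    by case: r => //= s t; rewrite (E 0).
  by apply: IH => i t; rewrite !addnA.
- by move=> P IHP Q IHQ a b c d E; congr Par; [exact: IHP|exact: IHQ].
- move=> p P IHP Q IHQ a b c d E; rewrite !cbnd_map; congr Timeout.
  + by case: p => //= s t; rewrite (E 0).
  + by apply: IHP => i t; rewrite !addnA.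
  + exact: IHQ.
- move=> [s ts] P IHP Q IHQ a b c d E; congr Ite; [|exact: IHP|exact: IHQ].
  rewrite /map_guard /=; congr Guard; rewrite -!map_comp.
  by apply: eq_map => t /=; rewrite (E 0).
- by move=> P IH a b c d E; congr Fix; apply: IH.
Qed.

(* Shifts and substitutions of value variables, as families indexed by the
   number of binders crossed. *)
Definition renaming_family f :=
  (forall k v, f k (TVal v) = TVal v) /\
  (forall i k t, f (i + k.+1) (shift_term i t) = shift_term i (f (i + k) t)).

Lemma renaming_shift : renaming_family (@shift_term S).
Proof.
split=> // i k [//|j] /=.
congr TVar; case: (leqP i j) => ij.
  rewrite addnS ltnS; case: (leqP (i + k) j) => // ikj; last by rewrite ij.
  by rewrite leqW.
have -> : (i + k.+1 <= j) = false by apply/negbTE; rewrite -ltnNge ltn_addr.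
have -> : (i + k <= j) = false by apply/negbTE; rewrite -ltnNge ltn_addr.
by rewrite leqNgt ij.
Qed.

Lemma renaming_subst v : renaming_family (@subst_term S v).
Proof.
split=> // i k [//|j] /=.
case: (leqP i j) => ij.
  rewrite addnS eqSS ltnS; case: eqP => [//|/eqP jn] /=; congr TVar.
  case: (ltngtP (i + k) j) jn => //= [lt|lt] _; last by rewrite ij.
  have j0 : 0 < j by apply: leq_trans lt.
  rewrite prednK //.
  have -> : i <= j.-1 by rewrite -ltnS prednK // (leq_ltn_trans _ lt) ?leq_addr.
  by [].
have jl m : (j == i + m) = false by rewrite ltn_eqF // ltn_addr.
have jg m : (i + m < j) = false.
  by apply/negbTE; rewrite -leqNgt ltnW // ltn_addr.
by rewrite !jl !jg /= leqNgt ij.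
Qed.

Lemma map_terms_vshift f k P : renaming_family f ->
  map_terms f k.+1 (vshift P) = vshift (map_terms f k P).
Proof.
by move=> [_ F]; apply: map_terms_exchange => i t; rewrite addn0 F.
Qed.

Lemma map_terms_vshift_iter f n k P : renaming_family f ->
  map_terms f (n + k) (iter n (@vshift S) P) =
  iter n (@vshift S) (map_terms f k P).
Proof. by move=> F; elim: n => //= n IH; rewrite map_terms_vshift // IH. Qed.

Lemma map_terms_pshift f k j P :
  map_terms f k (pshift j P) = pshift j (map_terms f k P).
Proof.
elim: P k j => //=.
- by move=> r P IH k j; rewrite IH.
- by move=> P IHP Q IHQ k j; rewrite IHP IHQ.
- by move=> p P IHP Q IHQ k j; rewrite IHP IHQ.
- by move=> b P IHP Q IHQ k j; rewrite IHP IHQ.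
- by move=> P IH k j; rewrite IH.
Qed.

(** At each value binder [R] is shifted once more; a renaming family commutes with precisely these
    shifts. *)
Lemma map_terms_psubst f k j R P : renaming_family f ->
  map_terms f k (psubst j R P) =
  psubst j (map_terms f k R) (map_terms f k P).
Proof.
move=> F; elim: P k j R => //=.
- by move=> r P IH k j R; rewrite IH bnd_map map_terms_vshift_iter.
- by move=> P IHP Q IHQ k j R; rewrite IHP IHQ.
- by move=> p P IHP Q IHQ k j R; rewrite IHP IHQ cbnd_map map_terms_vshift_iter.
- by move=> b P IHP Q IHQ k j R; rewrite IHP IHQ.
- by move=> X k j R; case: eqP.
- by move=> P IH k j R; rewrite IH map_terms_pshift.
Qed.

Lemma map_terms_unfold f k P : renaming_family f ->
  map_terms f k (unfold_fix P) = unfold_fix (map_terms f k P).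
Proof. by move=> F; rewrite /unfold_fix map_terms_psubst. Qed.

Lemma pshift_vshift_iter n j P :
  pshift j (iter n (@vshift S) P) = iter n (@vshift S) (pshift j P).
Proof. by elim: n => //= n IH; rewrite -map_terms_pshift IH. Qed.

Lemma psubst_vshift_iter n j R P :
  psubst j (iter n (@vshift S) R) (iter n (@vshift S) P) =
  iter n (@vshift S) (psubst j R P).
Proof.
elim: n => //= n IH; rewrite -IH /vshift map_terms_psubst //.
exact: renaming_shift.
Qed.

Lemma pshift_pshift j k P : j <= k ->
  pshift k.+1 (pshift j P) = pshift j (pshift k P).
Proof.
elim: P j k => //=.
- by move=> r P IH j k jk; rewrite IH.
- by move=> P IHP Q IHQ j k jk; rewrite IHP // IHQ.
- by move=> p P IHP Q IHQ j k jk; rewrite IHP // IHQ.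
- by move=> b P IHP Q IHQ j k jk; rewrite IHP // IHQ.
- move=> X j k jk; congr PVar.
  case: (leqP k X) => kX;
    first by rewrite (leq_trans jk kX) ltnS kX (leqW (leq_trans jk kX)).
  case: (leqP j X) => jX; first by rewrite ltnS leqNgt kX.
  by rewrite leqNgt (leqW kX).
- by move=> P IH j k jk; rewrite IH.
Qed.

Lemma psubst_pshift k R P : psubst k R (pshift k P) = P.
Proof.
elim: P k R => //=.
- by move=> r P IH k R; rewrite IH.
- by move=> P IHP Q IHQ k R; rewrite IHP IHQ.
- by move=> p P IHP Q IHQ k R; rewrite IHP IHQ.
- by move=> b P IHP Q IHQ k R; rewrite IHP IHQ.
- move=> X k R; case: (leqP k X) => kX; first by rewrite gtn_eqF // ltnS kX.
  by rewrite ltn_eqF // ltnNge (ltnW kX).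
- by move=> P IH k R; rewrite IH.
Qed.

Lemma pshift_psubst j k R P : j <= k ->
  pshift j (psubst k R P) = psubst k.+1 (pshift j R) (pshift j P).
Proof.
elim: P j k R => //=.
- by move=> r P IH j k R jk; rewrite IH // pshift_vshift_iter.
- by move=> P IHP Q IHQ j k R jk; rewrite IHP // IHQ.
- by move=> p P IHP Q IHQ j k R jk; rewrite IHP // IHQ // pshift_vshift_iter.
- by move=> b P IHP Q IHQ j k R jk; rewrite IHP // IHQ.
- move=> X j k R jk; case: (ltngtP X k) => [Xk|kX|->] /=.
  + case: (leqP j X) => jX;
      first by rewrite eqSS ltn_eqF //= ltnS ltnNge (ltnW Xk).
    by rewrite ltn_eqF ?leqW //= ltnNge (leqW (ltnW Xk)).
  + have X0 : 0 < X by apply: leq_trans kX.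
    rewrite (leq_trans jk (ltnW kX)) eqSS gtn_eqF //= ltnS kX prednK //.
    by rewrite -ltnS prednK // (leq_ltn_trans jk kX).
  + by rewrite jk eqxx.
- by move=> P IH j k R jk; rewrite IH // pshift_pshift.
Qed.

Lemma pshift_psubst_ge j k R P : j <= k ->
  pshift k (psubst j R P) = psubst j (pshift k R) (pshift k.+1 P).
Proof.
elim: P j k R => //=.
- by move=> r P IH j k R jk; rewrite IH // pshift_vshift_iter.
- by move=> P IHP Q IHQ j k R jk; rewrite IHP // IHQ.
- by move=> p P IHP Q IHQ j k R jk; rewrite IHP // IHQ // pshift_vshift_iter.
- by move=> b P IHP Q IHQ j k R jk; rewrite IHP // IHQ.
- move=> X j k R jk; case: (ltngtP X j) => [Xj|jX|->] /=.
  + have Xk : X < k by apply: leq_trans jk.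
    rewrite leqNgt Xk /= (ltnNge k) (ltnW Xk) /= ltn_eqF //.
    by rewrite ltnNge (ltnW Xj).
  + have X0 : 0 < X by apply: leq_trans jX.
    case: (ltnP k X) => kX.
      rewrite gtn_eqF ?(leqW jX) //= prednK //.
      by rewrite -ltnS prednK // kX.
    by rewrite gtn_eqF // jX -ltnS prednK // ltnNge kX /=.
  + by rewrite ltnNge jk /= eqxx.
- by move=> P IH j k R jk; rewrite IH // pshift_pshift.
Qed.

(** The substitution lemma for process variables. The only delicate index is [X = k.+1], where the
    shifted [R] is inserted first and the substitution for [j] must leave it unchanged. *)
Lemma psubst_psubst j k R T P : j <= k ->
  psubst k R (psubst j T P) =
  psubst j (psubst k R T) (psubst k.+1 (pshift j R) P).
Proof.
elim: P j k R T => //=.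
- by move=> r P IH j k R T jk;
    rewrite IH // pshift_vshift_iter psubst_vshift_iter.
- by move=> P IHP Q IHQ j k R T jk; rewrite IHP // IHQ.
- move=> p P IHP Q IHQ j k R T jk.
  by rewrite IHP // IHQ // pshift_vshift_iter psubst_vshift_iter.
- by move=> b P IHP Q IHQ j k R T jk; rewrite IHP // IHQ.
- move=> X j k R T jk; case: (ltngtP X j) => [Xj|jX|->] /=.
  + have Xk : X < k by apply: leq_trans jk.
    rewrite !ltn_eqF ?(leqW Xk) //= (ltnNge k) (ltnW Xk) ltnNge (leqW (ltnW
      Xk)) /=.
    by rewrite ltn_eqF // ltnNge (ltnW Xj).
  + have X0 : 0 < X by apply: leq_trans jX.
    have -> : (X == k.+1) = (X.-1 == k) by case: X X0 {jX}.
    case: eqP => [_|/eqP Xk]; first by rewrite psubst_pshift.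
    have -> : (k.+1 < X) = (k < X.-1) by case: X X0 {jX Xk}.
    case: (ltnP k X.-1) => kX /=; last by rewrite gtn_eqF // jX.
    by rewrite gtn_eqF ?(leq_ltn_trans jk) // (leq_ltn_trans jk).
  + by rewrite ltn_eqF ?ltnS //= ltnNge leqW //= eqxx.
- by move=> P IH j k R T jk; rewrite IH // pshift_psubst // pshift_pshift.
Qed.

Lemma pshift_unfold k P :
  pshift k (unfold_fix P) = unfold_fix (pshift k.+1 P).
Proof. by rewrite /unfold_fix pshift_psubst_ge. Qed.

(** The substitution lemma with [Fix P] as the inner process. It lets the unfolding rules of the
    congruence survive substitution. *)
Lemma psubst_unfold k R P :
  psubst k R (unfold_fix P) = unfold_fix (psubst k.+1 (pshift 0 R) P).
Proof. by rewrite /unfold_fix psubst_psubst. Qed.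

Lemma guard_is_map (f : term S -> term S) b r : (forall v, f (TVal v) = TVal
  v) ->
  guard_is b r -> guard_is (map_guard f b) r.
Proof.
move=> fv [vs E er]; exists vs => //=; rewrite E -map_comp.
by apply: eq_map => v /=.
Qed.

(** Ensures that a transition and a congruence step which both resolve a guard select the same
    branch. *)
Lemma guard_is_fun (b : @guard S) r r' : guard_is b r -> guard_is b r' -> r =
  r'.
Proof.
move=> [vs E <-] [vs' E' <-]; congr geval.
move: E'; rewrite E;
  elim: vs vs' {E} => [|v vs IH] [|v' vs'] //= [-> /IH ->] //.
Qed.

End Substitution.

(** * Parallel presentation of the structural congruence of processes *)

Section ParallelCongruence.

Context {S : signature}.
Implicit Types (P Q R T : proc S).

(* Structural congruence without transitivity. The unfolding and guard rules
   have a premise on the unfolded side, so that [peq] is closed under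
   substitution while a transition of a redex can be treated by induction on
   the transition and then on the derivation of [peq]. *)
Inductive peq : proc S -> proc S -> Prop :=
  | peq_nil : peq (@Nil S) (@Nil S)
  | peq_pre r P P' : peq P P' -> peq (Pre r P) (Pre r P')
  | peq_par P P' Q Q' : peq P P' -> peq Q Q' -> peq (Par P Q) (Par P' Q')
  | peq_timeout p P P' Q Q' :
      peq P P' -> peq Q Q' -> peq (Timeout p P Q) (Timeout p P' Q')
  | peq_ite b P P' Q Q' : peq P P' -> peq Q Q' -> peq (Ite b P Q) (Ite b P' Q')
  | peq_var X : peq (@PVar S X) (@PVar S X)
  | peq_fix P P' : peq P P' -> peq (Fix P) (Fix P')
  | peq_parC P P' Q Q' : peq P P' -> peq Q Q' -> peq (Par P Q) (Par Q' P')
  | peq_parA P P' Q Q' R R' : peq P P' -> peq Q Q' -> peq R R' ->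
      peq (Par (Par P Q) R) (Par P' (Par Q' R'))
  | peq_parA' P P' Q Q' R R' : peq P P' -> peq Q Q' -> peq R R' ->
      peq (Par P (Par Q R)) (Par (Par P' Q') R')
  | peq_par0l P P' : peq P P' -> peq (Par P (@Nil S)) P'
  | peq_par0r P P' : peq P P' -> peq P (Par P' (@Nil S))
  | peq_itel b r P Q R :
      guard_is b r -> peq (if r then P else Q) R -> peq (Ite b P Q) R
  | peq_iter b r P Q R :
      guard_is b r -> peq R (if r then P else Q) -> peq R (Ite b P Q)
  | peq_fixl P R : peq (unfold_fix P) R -> peq (Fix P) R
  | peq_fixr P R : peq R (unfold_fix P) -> peq R (Fix P).

Lemma peq_refl P : peq P P.
Proof. by elim: P; eauto using peq. Qed.

(** The rules come in mirror pairs. This replaces a symmetry constructor, which would spoil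
    inversion on the left process. *)
Lemma peq_sym P Q : peq P Q -> peq Q P.
Proof. by elim; eauto using peq. Qed.

Lemma pcong_ite_pick b r P Q : guard_is b r ->
  pcong (Ite b P Q) (if r then P else Q).
Proof. by case: r => ?; [apply: pcong_true|apply: pcong_false]. Qed.

Lemma peq_pcong P Q : peq P Q -> pcong P Q.
Proof.
elim=> {P Q}; try by eauto using @pcong.
- by move=> b r P Q R g _ h; apply: pcong_trans (pcong_ite_pick _ _ g) h.
- move=> b r P Q R g _ h.
  by apply: pcong_trans h (pcong_sym (pcong_ite_pick _ _ g)).
Qed.

Lemma peq_map_terms f k P Q : renaming_family f -> peq P Q ->
  peq (map_terms f k P) (map_terms f k Q).
Proof.
move=> F h; elim: h k => {P Q} /=; try by eauto using peq.
- move=> b r P Q R g _ h k; apply: (@peq_itel _ r).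
    by apply: guard_is_map g; case: F.
  by move: (h k); case: (r).
- move=> b r P Q R g _ h k; apply: (@peq_iter _ r).
    by apply: guard_is_map g; case: F.
  by move: (h k); case: (r).
- by move=> P R _ h k; apply: peq_fixl; rewrite -map_terms_unfold.
- by move=> P R _ h k; apply: peq_fixr; rewrite -map_terms_unfold.
Qed.

Lemma peq_vsubst v P Q : peq P Q -> peq (vsubst v P) (vsubst v Q).
Proof. exact: peq_map_terms (renaming_subst v). Qed.

Lemma peq_vshift_iter n P Q : peq P Q ->
  peq (iter n (@vshift S) P) (iter n (@vshift S) Q).
Proof.
by move=> h; elim: n => //= n IH; apply: peq_map_terms IH;
  apply: renaming_shift.
Qed.

Lemma peq_pshift k P Q : peq P Q -> peq (pshift k P) (pshift k Q).
Proof.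
move=> h; elim: h k => {P Q} /=; try by eauto using peq.
- move=> b r P Q R g _ h k; apply: peq_itel g _.
  by move: (h k); case: (r).
- move=> b r P Q R g _ h k; apply: peq_iter g _.
  by move: (h k); case: (r).
- by move=> P R _ h k; apply: peq_fixl; rewrite -pshift_unfold.
- by move=> P R _ h k; apply: peq_fixr; rewrite -pshift_unfold.
Qed.

Lemma peq_psubst k R R' P P' : peq R R' -> peq P P' ->
  peq (psubst k R P) (psubst k R' P').
Proof.
move=> hR h; elim: h k R R' hR => {P P'} /=;
  try by eauto using peq, peq_vshift_iter, peq_pshift.
- by move=> X k R R' hR; case: eqP => // _; apply: peq_refl.
- move=> b r P Q T g _ h k R R' hR; apply: peq_itel g _.
  by move: (h k R R' hR); case: (r).
- move=> b r P Q T g _ h k R R' hR; apply: peq_iter g _.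
  by move: (h k R R' hR); case: (r).
- by move=> P T _ h k R R' hR; apply: peq_fixl; rewrite -psubst_unfold;
    apply: h.
- by move=> P T _ h k R R' hR; apply: peq_fixr; rewrite -psubst_unfold;
    apply: h.
Qed.

(** The reason for a parallel relation: the copies of the body created by unfolding, and the
    recursions substituted into it, are all rewritten in a single step. *)
Lemma peq_unfold P Q : peq P Q -> peq (unfold_fix P) (unfold_fix Q).
Proof. by move=> h; apply: (peq_psubst 0 (peq_fix h) h). Qed.

Inductive peq_star : proc S -> proc S -> Prop :=
  | peq_star_refl P : peq_star P P
  | peq_star_step P Q R : peq P Q -> peq_star Q R -> peq_star P R.

Lemma peq_star_trans P Q R : peq_star P Q -> peq_star Q R -> peq_star P R.
Proof. by move=> h; elim: h => // {}P {}Q T h _ IH /IH;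
  apply: peq_star_step. Qed.

Lemma peq_star1 P Q : peq P Q -> peq_star P Q.
Proof. by move=> h; apply: peq_star_step h (peq_star_refl _). Qed.

Lemma peq_star_sym P Q : peq_star P Q -> peq_star Q P.
Proof.
elim=> [?|{}P {}Q R h _ IH]; first exact: peq_star_refl.
by apply: peq_star_trans IH _; apply/peq_star1/peq_sym.
Qed.

Lemma peq_star_map (F : proc S -> proc S) P Q :
  (forall P Q, peq P Q -> peq (F P) (F Q)) -> peq_star P Q ->
  peq_star (F P) (F Q).
Proof.
move=> hF; elim=> [?|{}P {}Q R h _ IH]; first exact: peq_star_refl.
by apply: peq_star_step IH; apply: hF.
Qed.

Lemma peq_star_map2 (F : proc S -> proc S -> proc S) P P' Q Q' :
  (forall P P' Q Q', peq P P' -> peq Q Q' -> peq (F P Q) (F P' Q')) ->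
  peq_star P P' -> peq_star Q Q' -> peq_star (F P Q) (F P' Q').
Proof.
move=> hF hP hQ; apply: (@peq_star_trans _ (F P' Q)).
  by apply: (@peq_star_map (F^~ Q)) hP => ? ? h; apply: hF => //;
    apply: peq_refl.
by apply: (@peq_star_map (F P')) hQ => ? ? h; apply: hF => //; apply: peq_refl.
Qed.

Lemma pcong_peq_star P Q : pcong P Q -> peq_star P Q.
Proof.
elim=> {P Q}; try by move=> *; apply: peq_star1; eauto using peq, peq_refl.
- by move=> P Q _; apply: peq_star_sym.
- by move=> P Q R _ h _; apply: peq_star_trans.
- by move=> r P P' _; apply: peq_star_map; eauto using peq.
- by move=> P P' Q Q' _ hP _; apply: peq_star_map2 hP; eauto using peq.
- by move=> p P P' Q Q' _ hP _; apply: peq_star_map2 hP; eauto using peq.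
- by move=> b P P' Q Q' _ hP _; apply: peq_star_map2 hP; eauto using peq.
- by move=> P P' _; apply: peq_star_map; eauto using peq.
Qed.

(* Inversion of [peq P Q] up to the rules which only act on [Q]. *)
Definition peq_left P Q : Prop :=
  match P with
  | Nil => Q = Nil
  | PVar X => Q = PVar X
  | Pre r A => exists2 A', peq A A' & Q = Pre r A'
  | Timeout p A B =>
      exists A' B', [/\ peq A A', peq B B' & Q = Timeout p A' B']
  | Ite b A B =>
      (exists A' B', [/\ peq A A', peq B B' & Q = Ite b A' B'])
      \/ exists2 r, guard_is b r & peq (if r then A else B) Q
  | Fix A => (exists2 A', peq A A' & Q = Fix A') \/ peq (unfold_fix A) Q
  | Par A B =>
      [\/ exists A' B',
            [/\ peq A A', peq B B' & Q = Par A' B' \/ Q = Par B' A'],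
          exists A1 A2 A1' A2' B',
            [/\ A = Par A1 A2, peq A1 A1', peq A2 A2', peq B B'
              & Q = Par A1' (Par A2' B')],
          exists B1 B2 B1' B2' A',
            [/\ B = Par B1 B2, peq B1 B1', peq B2 B2', peq A A'
              & Q = Par (Par A' B1') B2']
        | B = Nil /\ peq A Q]
  end.

(** Rules that rewrite only the right process can be iterated; they are absorbed by closure
    conditions on [K], which leaves one case per shape of [P]. *)
Lemma peq_right_ind P (K : proc S -> Prop) :
  (forall Q, peq_left P Q -> K Q) ->
  (forall Q, K Q -> K (Par Q (@Nil S))) ->
  (forall b r Q R, guard_is b r -> K (if r then Q else R) -> K (Ite b Q R)) ->
  (forall Q, K (unfold_fix Q) -> K (Fix Q)) ->
  forall Q, peq P Q -> K Q.
Proof.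
move=> hl h0 hi hf Q h; elim: h hl => {P Q} /=;
  try by move=> *; match goal with H : forall Q, _ -> K Q |- _ => apply: H end;
    eauto using peq.
- by move=> P P' Q Q' hP _ hQ _; apply; constructor 1; exists P', Q'; split;
    auto.
- by move=> p P P' Q Q' hP _ hQ _; apply; exists P', Q'.
- by move=> b P P' Q Q' hP _ hQ _; apply; left; exists P', Q'.
- by move=> P P' Q Q' hP _ hQ _; apply; constructor 1; exists P', Q'; split;
    auto.
- by move=> P P' Q Q' R R' hP _ hQ _ hR _; apply; constructor 2;
    exists P, Q, P', Q', R'.
- by move=> P P' Q Q' R R' hP _ hQ _ hR _; apply; constructor 3;
    exists Q, R, Q', R', P'.
- by move=> P P' hP _; apply; constructor 4.
- by move=> P P' _ IH hl; apply: h0; apply: IH.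
- by move=> b r P Q R g _ IH hl; apply: (hi _ _ _ _ g); apply: IH.
- by move=> P R _ IH hl; apply: hf; apply: IH.
Qed.

End ParallelCongruence.

(** * Structural congruence is a bisimulation for process transitions *)

Section ProcessTransitions.

Context {S : signature}.
Implicit Types (P Q R T : proc S).

Inductive head_act : plabel -> proc S -> proc S -> Prop :=
  | head_out c v P Q : head_act (POut c v) (Timeout (Out c (TVal v)) P Q) P
  | head_in c v P Q : head_act (PIn c v) (Timeout (In c) P Q) (vsubst v P)
  | head_read s v P : head_act (PRead s v) (Pre (Read s) P) (vsubst v P)
  | head_write a v P : head_act (PWrite a v) (Pre (Write a (TVal v)) P) P
  | head_pos h P : head_act (PPos h) (Pre (@Pos S) P) (vsubst (vloc h) P).

(** Symmetric in the two labels, so that the left and the right communication rule become the single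
    constructor [act_com]. *)
Definition psync (l1 l2 : @plabel S) : Prop :=
  match l1, l2 with
  | POut c v, PIn c' v' | PIn c v, POut c' v' =>
      [/\ c = c', v = v' & rng c = RLocal]
  | _, _ => False
  end.

Inductive act : plabel -> proc S -> proc S -> Prop :=
  | act_head l P P' : head_act l P P' -> act l P P'
  | act_com l1 l2 P P' Q Q' : psync l1 l2 ->
      act l1 P P' -> act l2 Q Q' -> act (@PTau S) (Par P Q) (Par P' Q')
  | act_parl l P P' Q : act l P P' -> act l (Par P Q) (Par P' Q)
  | act_parr l P P' Q : act l P P' -> act l (Par Q P) (Par Q P')
  | act_fix l P Q : act l (unfold_fix P) Q -> act l (Fix P) Q
  | act_ite l b r P Q P' :
      guard_is b r -> act l (if r then P else Q) P' -> act l (Ite b P Q) P'.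

Lemma psyncC l1 l2 : psync l1 l2 -> psync l2 l1.
Proof. by case: l1 l2 => [|c v|c v|h|s v|a v] [|c' v'|c' v'|h'|s' v'|a' v']
  //= [-> ->]. Qed.

Lemma actP l P P' : ptrans l P P' <-> act l P P'.
Proof.
split; elim=> {l P P'}; try by eauto using act, head_act.
- move=> c v P P' Q Q' _ hP _ hQ r.
  by apply: (@act_com (POut c v) (PIn c v)) => //; split.
- move=> c v P P' Q Q' _ hP _ hQ r.
  by apply: (@act_com (PIn c v) (POut c v)) => //; split.
- by move=> l P P' []; eauto using @ptrans.
- move=> [|c v|c v|h|s v|a v] [|c' v'|c' v'|h'|s' v'|a' v'] P P' Q Q' //=;
    move=> [<- <- r] _ h _ h'; first exact: ptrans_coml h h' r.
  exact: ptrans_comr h' h r.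
- by move=> l P P' Q _; apply: ptrans_parl.
- by move=> l P P' Q _; apply: ptrans_parr.
- by move=> l P P' _; apply: ptrans_fix.
- by move=> l b [] P Q P' g _; [apply: ptrans_true|apply: ptrans_false].
Qed.

Lemma act_par_inv l P Q T : act l (Par P Q) T ->
  [\/ exists2 P', act l P P' & T = Par P' Q,
      exists2 Q', act l Q Q' & T = Par P Q'
    | l = PTau /\ exists l1 l2 P' Q',
        [/\ psync l1 l2, act l1 P P', act l2 Q Q' & T = Par P' Q']].
Proof.
move E: (Par P Q) => A h; case: h E => //=.
- by move=> ? ? ? [].
- move=> l1 l2 A1 A1' A2 A2' s h1 h2 [-> ->]; constructor 3; split=> //.
  by exists l1, l2, A1', A2'.
- by move=> {}l A1 A1' A2 h [-> ->]; constructor 1; exists A1'.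
- by move=> {}l A1 A1' A2 h [-> ->]; constructor 2; exists A1'.
Qed.

Lemma act_nil l T : ~ act l (@Nil S) T.
Proof.
by move E: (@Nil S) => A h; case: h E => // ? ? ? [].
Qed.

Lemma head_act_peq l P P1 Q : head_act l P P1 -> peq P Q ->
  exists2 Q1, act l Q Q1 & pcong P1 Q1.
Proof.
move=> hP; move: Q; apply: peq_right_ind.
- case: hP => /=.
  + move=> c v A B _ [A' [B' [hA _ ->]]].
    by exists A'; [apply: act_head; constructor|apply: peq_pcong].
  + move=> c v A B _ [A' [B' [hA _ ->]]]; exists (vsubst v A').
      by apply: act_head; constructor.
    exact/peq_pcong/peq_vsubst.
  + move=> s v A _ [A' hA ->]; exists (vsubst v A').
      by apply: act_head; constructor.
    exact/peq_pcong/peq_vsubst.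
  + move=> a v A _ [A' hA ->].
    by exists A'; [apply: act_head; constructor|apply: peq_pcong].
  + move=> h A _ [A' hA ->]; exists (vsubst (vloc h) A').
      by apply: act_head; constructor.
    exact/peq_pcong/peq_vsubst.
- move=> Q [Q1 h e]; exists (Par Q1 (@Nil S)); first exact: act_parl.
  by apply: pcong_trans e (pcong_sym (pcong_par0 _)).
- by move=> b r Q R g [Q1 h e]; exists Q1 => //; apply: act_ite g h.
- by move=> Q [Q1 h e]; exists Q1 => //; apply: act_fix.
Qed.

Lemma pcong_parAl R P' Q' R' T : pcong T (Par P' Q') -> pcong R R' ->
  pcong (Par T R) (Par P' (Par Q' R')).
Proof. by move=> h hR; apply: pcong_trans (pcong_parA _ _ _);
  apply: pcong_par. Qed.

Lemma pcong_parAr P P' Q' R' T : pcong P P' -> pcong T (Par Q' R') ->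
  pcong (Par P T) (Par (Par P' Q') R').
Proof.
move=> hP h; apply: pcong_trans (pcong_sym (pcong_parA _ _ _)).
exact: pcong_par.
Qed.

Lemma pcong_par_swap P P' Q Q' : pcong P P' -> pcong Q Q' ->
  pcong (Par P Q) (Par Q' P').
Proof. by move=> hP hQ; apply: pcong_trans (pcong_parC _ _) _;
  apply: pcong_par. Qed.

(** The outer induction on the transition settles recursion: a step of [Fix A] is a step of its
    unfolding with a smaller derivation, and [peq_unfold] carries related bodies to related
    unfoldings, so the induction hypothesis applies to these larger processes. *)
Lemma act_peq l P P1 : act l P P1 -> forall Q, peq P Q ->
  exists2 Q1, act l Q Q1 & pcong P1 Q1.
Proof.
(* Shared by all cases: a step survives an added [Nil], a guard put in front, or a folded recursion
   on the right. *)
have right K P0 P1' l0 :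
    K = (fun Q => exists2 Q1, act l0 Q Q1 & pcong P1' Q1) ->
    (forall Q, peq_left P0 Q -> K Q) -> forall Q, peq P0 Q -> K Q.
  move=> -> hl; apply: peq_right_ind => //.
  - move=> Q [Q1 h e]; exists (Par Q1 (@Nil S)); first exact: act_parl.
    by apply: pcong_trans e (pcong_sym (pcong_par0 _)).
  - by move=> b r Q R g [Q1 h e]; exists Q1 => //; apply: act_ite g h.
  - by move=> Q [Q1 h e]; exists Q1 => //; apply: act_fix.
elim=> {l P P1}.
- by move=> l P P1 h Q; apply: head_act_peq.
- move=> l1 l2 A A1 B B1 s hA IHA hB IHB; apply: right => // Q /= [].
  + move=> [A' [B' [/IHA [A1' hA' eA] /IHB [B1' hB' eB] [->|->]]]].
      by exists (Par A1' B1'); [apply: act_com s hA' hB'|apply: pcong_par].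
    exists (Par B1' A1'); first by apply: act_com (psyncC s) hB' hA'.
    exact: pcong_par_swap.
  (* Re-association splits [A]. The hypothesis for [A] is applied to the rebuilt [Par C' D'], and
     inversion tells which component synchronises; a tau-step is excluded because [psync] relates no
     [PTau]. *)
  + move=> [C [D [C' [D' [B' [EA hC hD /IHB [B1' hB' eB] ->]]]]]].
    have /IHA [A1' hA' eA] : peq A (Par C' D') by rewrite EA; apply: peq_par.
    case: (act_par_inv hA') => [[X hX E]|[X hX E]|[E _]];
      last by rewrite E in s.
      exists (Par X (Par D' B1')); first by apply: act_com s hX _;
        apply: act_parr.
      by apply: pcong_parAl _ eB; rewrite -E.
    exists (Par C' (Par X B1')); first by apply: act_parr;
      apply: act_com s hX hB'.
    by apply: pcong_parAl _ eB; rewrite -E.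
  + move=> [C [D [C' [D' [A' [EB hC hD /IHA [A1' hA' eA] ->]]]]]].
    have /IHB [B1' hB' eB] : peq B (Par C' D') by rewrite EB; apply: peq_par.
    case: (act_par_inv hB') => [[X hX E]|[X hX E]|[E _]].
    * exists (Par (Par A1' X) D'); first by apply: act_parl;
        apply: act_com s hA' hX.
      by apply: pcong_parAr eA _; rewrite -E.
    * exists (Par (Par A1' C') X); first by apply: act_com s _ hX;
        apply: act_parl.
      by apply: pcong_parAr eA _; rewrite -E.
    * by move: (psyncC s); rewrite E.
  + by move=> [E _]; case: (@act_nil l2 B1); rewrite -E.
- move=> l A A1 B hA IHA; apply: right => // Q /= [].
  + move=> [A' [B' [/IHA [A1' hA' eA] /peq_pcong hB [->|->]]]].
      by exists (Par A1' B'); [apply: act_parl|apply: pcong_par].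
    by exists (Par B' A1'); [apply: act_parr|apply: pcong_par_swap].
  + move=> [C [D [C' [D' [B' [EA hC hD /peq_pcong hB ->]]]]]].
    have /IHA [A1' hA' eA] : peq A (Par C' D') by rewrite EA; apply: peq_par.
    case: (act_par_inv hA') => [[X hX E]|[X hX E]|[E [l1 [l2 [X [Y [s hX hY
      E']]]]]]].
    * exists (Par X (Par D' B')); first exact: act_parl.
      by apply: pcong_parAl _ hB; rewrite -E.
    * exists (Par C' (Par X B')); first by apply: act_parr; apply: act_parl.
      by apply: pcong_parAl _ hB; rewrite -E.
    (* The communication was internal to [A], and its partners now lie on different sides of the
       outer composition. *)
    * exists (Par X (Par Y B')).
        by rewrite E; apply: act_com s hX _; apply: act_parl.
      by apply: pcong_parAl _ hB; rewrite -E'.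
  + move=> [C [D [C' [D' [A' [EB hC hD /IHA [A1' hA' eA] ->]]]]]].
    exists (Par (Par A1' C') D'); first by do 2!apply: act_parl.
    by rewrite EB; apply: pcong_parAr eA _; apply: pcong_par; apply: peq_pcong.
  + move=> [-> /IHA [A1' hA' eA]]; exists A1' => //.
    by apply: pcong_trans (pcong_par0 _) eA.
- move=> l B B1 A hB IHB; apply: right => // Q /= [].
  + move=> [A' [B' [/peq_pcong hA /IHB [B1' hB' eB] [->|->]]]].
      by exists (Par A' B1'); [apply: act_parr|apply: pcong_par].
    by exists (Par B1' A'); [apply: act_parl|apply: pcong_par_swap].
  + move=> [C [D [C' [D' [B' [EA hC hD /IHB [B1' hB' eB] ->]]]]]].
    exists (Par C' (Par D' B1')); first by do 2!apply: act_parr.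
    by rewrite EA; apply: pcong_parAl _ eB; apply: pcong_par; apply: peq_pcong.
  + move=> [C [D [C' [D' [A' [EB hC hD /peq_pcong hA ->]]]]]].
    have /IHB [B1' hB' eB] : peq B (Par C' D') by rewrite EB; apply: peq_par.
    case: (act_par_inv hB') => [[X hX E]|[X hX E]|[E [l1 [l2 [X [Y [s hX hY
      E']]]]]]].
    * exists (Par (Par A' X) D'); first by apply: act_parl; apply: act_parr.
      by apply: pcong_parAr hA _; rewrite -E.
    * exists (Par (Par A' C') X); first exact: act_parr.
      by apply: pcong_parAr hA _; rewrite -E.
    * exists (Par (Par A' X) Y).
        by rewrite E; apply: act_com s _ hY; apply: act_parr.
      by apply: pcong_parAr hA _; rewrite -E'.
  + by move=> [E _]; case: (@act_nil l B1); rewrite -E.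
- move=> l A A1 hA IHA; apply: right => // Q /= [[A' h ->]|/IHA //].
  have /IHA [A1' hA' eA] := peq_unfold h.
  by exists A1' => //; apply: act_fix.
- move=> l b r A B A1 g hA IHA; apply: right => // Q /= [[A' [B' [h1 h2 ->]]]|].
    have /IHA [A1' hA' eA] : peq (if r then A else B) (if r then A' else B').
      by case: (r).
    by exists A1' => //; apply: act_ite g hA'.
  by move=> [r' g' h]; apply: IHA; rewrite (guard_is_fun g g').
Qed.

Lemma act_pcong l P P1 Q : pcong P Q -> act l P P1 ->
  exists2 Q1, act l Q Q1 & pcong P1 Q1.
Proof.
move=> /pcong_peq_star h; elim: h P1 => {P Q} [P|P Q R h _ IH] P1 hP.
  by exists P1 => //; apply: pcong_refl.
have [Q1 /IH [R1 hR e'] e] := act_peq hP h.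
by exists R1 => //; apply: pcong_trans e e'.
Qed.

Definition quiet P := ~ exists R, act (@PTau S) P R.

Lemma quietP P : quiet P <-> ~ exists R, ptrans (@PTau S) P R.
Proof. by split=> h [R /actP hR]; apply: h; exists R. Qed.

Lemma quiet_pcong P Q : pcong P Q -> quiet P -> quiet Q.
Proof.
move=> e h [R hR]; have [R' hR' _] := act_pcong (pcong_sym e) hR.
by apply: h; exists R'.
Qed.

Lemma quiet_parl P Q : quiet (Par P Q) -> quiet P.
Proof. by move=> h [R hR]; apply: h; exists (Par R Q); apply: act_parl. Qed.

Lemma quiet_parr P Q : quiet (Par P Q) -> quiet Q.
Proof. by move=> h [R hR]; apply: h; exists (Par P R); apply: act_parr. Qed.

Lemma tick_par P P' Q Q' : ptick P P' -> ptick Q Q' -> quiet (Par P Q) ->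
  ptick (Par P Q) (Par P' Q').
Proof. by move=> hP hQ /quietP; apply: ptick_par. Qed.

Lemma ptick_par_inv P Q T : ptick (Par P Q) T ->
  exists P' Q', [/\ ptick P P', ptick Q Q', quiet (Par P Q) & T = Par P' Q'].
Proof.
move E: (Par P Q) => A h; case: h E => //= P0 P' Q0 Q' hP hQ n [-> ->].
by exists P', Q'; split=> //; apply/quietP.
Qed.

Lemma ptick_ite b r P Q P' : guard_is b r -> ptick (if r then P else Q) P' ->
  ptick (Ite b P Q) P'.
Proof. by case: r; [apply: ptick_true|apply: ptick_false]. Qed.

(** The axioms concern processes without tau-steps, and the parallel rule has quietness as a
    premise. This supplies the side condition when a ticking process is put in parallel with
    [Nil]. *)
Lemma ptick_quiet P P' : ptick P P' -> quiet P.
Proof.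
have inv A R : act (@PTau S) A R -> match A with
    | Nil | Pre _ _ | Timeout _ _ _ | PVar _ => False
    | Fix B => act (@PTau S) (unfold_fix B) R
    | Ite b B C => exists2 r, guard_is b r & act (@PTau S) (if r then B else
      C) R
    | Par _ _ => True end.
  move E: (@PTau S) => l h; case: h E => //.
  - by move=> ? ? ? [].
  - by move=> ? b r B C B' g h E; exists r.
elim=> {P P'}.
- by move=> [R /inv].
- by move=> P [R /inv].
- by move=> p P Q [R /inv].
- by move=> P P' Q Q' _ _ _ _ /quietP.
- by move=> P Q _ h [R /inv hR]; apply: h; exists R.
- move=> b P Q P' g _ h [R /inv [r g' hR]]; apply: h; exists R.
  by move: hR; rewrite -(guard_is_fun g g').
- move=> b P Q P' g _ h [R /inv [r g' hR]]; apply: h; exists R.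
  by move: hR; rewrite -(guard_is_fun g g').
Qed.

(** Same double induction as for actions. The negative premise is harmless because quietness is
    already known to be invariant under congruence. *)
Lemma ptick_peq P P1 : ptick P P1 -> forall Q, peq P Q ->
  exists2 Q1, ptick Q Q1 & pcong P1 Q1.
Proof.
have right K P0 P1' :
    K = (fun Q => exists2 Q1, ptick Q Q1 & pcong P1' Q1) ->
    (forall Q, peq_left P0 Q -> K Q) -> forall Q, peq P0 Q -> K Q.
  move=> -> hl; apply: peq_right_ind => //.
  - move=> Q [Q1 h e]; exists (Par Q1 (@Nil S)).
      apply: (tick_par h (@ptick_nil S)).
      exact: quiet_pcong (pcong_sym (pcong_par0 _)) (ptick_quiet h).
    by apply: pcong_trans e (pcong_sym (pcong_par0 _)).
  - by move=> b r Q R g [Q1 h e]; exists Q1 => //; apply: ptick_ite g h.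
  - by move=> Q [Q1 h e]; exists Q1 => //; apply: ptick_fix.
elim=> {P P1}.
- by apply: right => // Q /= ->; exists (@Nil S); constructor.
- move=> P; apply: right => // Q /= [A' hA ->].
  by exists A'; [constructor|apply: peq_pcong].
- move=> p P Q; apply: right => // _ /= [A' [B' [hA hB ->]]].
  by exists B'; [constructor|apply: peq_pcong].
- move=> A A1 B B1 hA IHA hB IHB /quietP q; apply: right => // Q hl.
  (* Quietness of the whole rearranged product comes first; that of each newly formed subproduct is
     then inherited from it. *)
  have qQ : quiet Q.
    apply: quiet_pcong q; apply: peq_pcong; case: hl.
    + by move=> [A' [B' [? ? [->|->]]]]; eauto using @peq.
    + by move=> [C [D [C' [D' [B' [-> ? ? ? ->]]]]]]; eauto using @peq.
    + by move=> [C [D [C' [D' [B' [-> ? ? ? ->]]]]]]; eauto using @peq.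
    + by move=> [-> ?]; eauto using @peq.
  case: hl qQ.
  + move=> [A' [B' [/IHA [A1' hA' eA] /IHB [B1' hB' eB] [->|->]]]] qQ.
      by exists (Par A1' B1'); [apply: tick_par|apply: pcong_par].
    by exists (Par B1' A1'); [apply: tick_par|apply: pcong_par_swap].
  + move=> [C [D [C' [D' [B' [EA hC hD /IHB [B1' hB' eB] ->]]]]]] qQ.
    have /IHA [A1' hA' eA] : peq A (Par C' D') by rewrite EA; apply: peq_par.
    have [X [Y [hX hY _ E]]] := ptick_par_inv hA'.
    exists (Par X (Par Y B1')); last by apply: pcong_parAl _ eB; rewrite -E.
    by apply: (tick_par hX _ qQ); apply: tick_par hY hB' (quiet_parr qQ).
  + move=> [C [D [C' [D' [A' [EB hC hD /IHA [A1' hA' eA] ->]]]]]] qQ.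
    have /IHB [B1' hB' eB] : peq B (Par C' D') by rewrite EB; apply: peq_par.
    have [X [Y [hX hY _ E]]] := ptick_par_inv hB'.
    exists (Par (Par A1' X) Y); last by apply: pcong_parAr eA _; rewrite -E.
    by apply: (tick_par _ hY qQ); apply: tick_par hA' hX (quiet_parl qQ).
  + move=> [E /IHA [A1' hA' eA]] _; exists A1' => //.
    have -> : B1 = @Nil S by rewrite E in hB; inversion hB.
    by apply: pcong_trans (pcong_par0 _) eA.
- move=> A A1 hA IHA; apply: right => // Q /= [[A' h ->]|/IHA //].
  have /IHA [A1' hA' eA] := peq_unfold h.
  by exists A1' => //; apply: ptick_fix.
- move=> b A B A1 g hA IHA; apply: right => // Q /= [[A' [B' [h1 h2 ->]]]|].
    have [A1' hA' eA] := IHA _ h1.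
    by exists A1' => //; apply: ptick_true.
  by move=> [r' g' h]; apply: IHA; rewrite -(guard_is_fun g g') in h.
- move=> b A B A1 g hA IHA; apply: right => // Q /= [[A' [B' [h1 h2 ->]]]|].
    have [A1' hA' eA] := IHA _ h2.
    by exists A1' => //; apply: ptick_false.
  by move=> [r' g' h]; apply: IHA; rewrite -(guard_is_fun g g') in h.
Qed.

Lemma ptick_pcong P P1 Q : pcong P Q -> ptick P P1 ->
  exists2 Q1, ptick Q Q1 & pcong P1 Q1.
Proof.
move=> /pcong_peq_star h; elim: h P1 => {P Q} [P|P Q R h _ IH] P1 hP.
  by exists P1 => //; apply: pcong_refl.
have [Q1 /IH [R1 hR e'] e] := ptick_peq hP h.
by exists R1 => //; apply: pcong_trans e e'.
Qed.

End ProcessTransitions.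

(** * Invariants of processes preserved by transitions *)

Section Names.

Context {S : signature}.
Implicit Types (P Q R T : proc S).

(** A common interface for name bounds, closedness and guardedness. The clause for [Par] is an
    equivalence because the residuals of the two components have to be put together again. *)
Record hereditary (K : proc S -> Prop) : Prop := {
  hereditary_par P Q : K (Par P Q) <-> K P /\ K Q;
  hereditary_ite b P Q : K (Ite b P Q) -> K P /\ K Q;
  hereditary_fix P : K (Fix P) -> K (unfold_fix P);
  hereditary_timeout p P Q : K (Timeout p P Q) -> K Q;
  hereditary_sleep P : K (Pre (@Sleep S) P) -> K P;
  hereditary_head l P P' : head_act l P P' -> K P -> K P'
}.

Lemma act_hereditary K l P P' : hereditary K -> act l P P' -> K P -> K P'.
Proof.
move=> hK; elim=> {l P P'}.
- by move=> l P P'; apply: (hereditary_head hK).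
- move=> l1 l2 P P' Q Q' _ _ hP _ hQ /(hereditary_par hK) [kP kQ].
  by apply/(hereditary_par hK); split; [apply: hP|apply: hQ].
- move=> l P P' Q _ hP /(hereditary_par hK) [kP kQ].
  by apply/(hereditary_par hK); split=> //; apply: hP.
- move=> l P P' Q _ hP /(hereditary_par hK) [kQ kP].
  by apply/(hereditary_par hK); split=> //; apply: hP.
- by move=> l P Q _ h /(hereditary_fix hK).
- by move=> l b [] P Q P' _ _ h /(hereditary_ite hK) [? ?]; apply: h.
Qed.

Lemma ptick_hereditary K P P' : hereditary K -> ptick P P' -> K P -> K P'.
Proof.
move=> hK; elim=> {P P'} //.
- by move=> P; apply: (hereditary_sleep hK).
- by move=> p P Q; apply: (hereditary_timeout hK).
- move=> P P' Q Q' _ hP _ hQ _ /(hereditary_par hK) [kP kQ].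
  by apply/(hereditary_par hK); split; [apply: hP|apply: hQ].
- by move=> P Q _ h /(hereditary_fix hK).
- by move=> b P Q P' _ _ h /(hereditary_ite hK) [? ?]; apply: h.
- by move=> b P Q P' _ _ h /(hereditary_ite hK) [? ?]; apply: h.
Qed.

Section Collect.

Variables (T : eqType) (pn : @prefix S -> seq T) (cn : @cprefix S -> seq T).
Hypothesis pn_map : forall f r, pn (map_prefix f r) = pn r.
Hypothesis cn_map : forall f p, cn (map_cprefix f p) = cn p.

(** Common generalisation of [sensors], [actuators] and [pchans], so that their behaviour under
    substitution is studied once. *)
Fixpoint names P : seq T :=
  match P with
  | Nil | PVar _ => [::]
  | Pre r P => pn r ++ names P
  | Par P Q | Ite _ P Q => names P ++ names Q
  | Timeout p P Q => cn p ++ names P ++ names Q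
  | Fix P => names P
  end.

Lemma names_map_terms f k P : names (map_terms f k P) = names P.
Proof.
elim: P k => //=.
- by move=> r P IH k; rewrite pn_map IH.
- by move=> P IHP Q IHQ k; rewrite IHP IHQ.
- by move=> p P IHP Q IHQ k; rewrite cn_map IHP IHQ.
- by move=> b P IHP Q IHQ k; rewrite IHP IHQ.
Qed.

Lemma names_vshift_iter n P : names (iter n (@vshift S) P) = names P.
Proof. by elim: n => //= n IH; rewrite names_map_terms. Qed.

Lemma names_pshift k P : names (pshift k P) = names P.
Proof.
elim: P k => //=.
- by move=> r P IH k; rewrite IH.
- by move=> P IHP Q IHQ k; rewrite IHP IHQ.
- by move=> p P IHP Q IHQ k; rewrite IHP IHQ.
- by move=> b P IHP Q IHQ k; rewrite IHP IHQ.
Qed.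

Lemma names_psubst k R P : {subset names (psubst k R P) <= names P ++ names R}.
Proof.
have app (s t u s' t' : seq T) : {subset s <= s' ++ u} -> {subset t <= t' ++
  u} ->
    {subset s ++ t <= (s' ++ t') ++ u}.
  move=> h h' x; rewrite !mem_cat => /orP[/h|/h']; rewrite mem_cat.
    by case/orP=> -> //; rewrite ?orbT.
  by case/orP=> -> //; rewrite ?orbT.
have sub (s u : seq T) : {subset s <= s ++ u} by move=> x;
  rewrite mem_cat => ->.
elim: P k R => //=.
- move=> r P IH k R; apply: app => //.
  by have := IH k (iter (bnd r) (@vshift S) R); rewrite names_vshift_iter.
- by move=> P IHP Q IHQ k R; apply: app.
- move=> p P IHP Q IHQ k R; apply: (app) => //; apply: (app) => //.
  by have := IHP k (iter (cbnd p) (@vshift S) R); rewrite names_vshift_iter.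
- by move=> b P IHP Q IHQ k R; apply: app.
- by move=> X k R x; case: eqP.
- by move=> P IH k R; have := IH k.+1 (pshift 0 R); rewrite names_pshift.
Qed.

(** What is substituted is the recursion itself, which brings in only the names of its own body. *)
Lemma names_unfold P : {subset names (unfold_fix P) <= names P}.
Proof. by move=> x /names_psubst; rewrite mem_cat /= orbb. Qed.

Lemma names_hereditary (L : seq T) :
  hereditary (fun P => {subset names P <= L}).
Proof.
have catP (s t : seq T) :
    {subset s ++ t <= L} <-> {subset s <= L} /\ {subset t <= L}.
  split=> [h|[h h'] x]; first by split=> x xs; apply: h;
    rewrite mem_cat xs ?orbT.
  by rewrite mem_cat => /orP[/h|/h'].
split=> /=.
- by move=> P Q; apply: catP.
- by move=> b P Q /catP.
- by move=> P h x /names_unfold /h.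
- by move=> p P Q /catP [_ /catP []].
- by move=> P /catP [].
- by move=> l P P' [c v A B|c v A B|s v A|a v A|h A] /= /catP [_];
    rewrite ?names_map_terms //; case/catP.
Qed.

End Collect.

Definition prefix_sensors (r : @prefix S) := if r is Read s then [:: s] else
  [::].
Definition prefix_actuators (r : @prefix S) := if r is Write a _ then [:: a]
  else [::].
Definition cprefix_chans (p : @cprefix S) := match p with Out c _ | In c =>
  [:: c] end.

Lemma sensorsE P : sensors P = names prefix_sensors (fun=> [::]) P.
Proof.
elim: P => //=.
- by move=> [||s|a t] P ->.
- by move=> P -> Q ->.
- by move=> p P -> Q ->.
- by move=> b P -> Q ->.
Qed.

Lemma actuatorsE P : actuators P = names prefix_actuators (fun=> [::]) P.
Proof.
elim: P => //=.
- by move=> [||s|a t] P ->.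
- by move=> P -> Q ->.
- by move=> p P -> Q ->.
- by move=> b P -> Q ->.
Qed.

Lemma pchansE P : pchans P = names (fun=> [::]) cprefix_chans P.
Proof.
elim: P => //=.
- by move=> P -> Q ->.
- by move=> [c t|c] P -> Q ->.
- by move=> b P -> Q ->.
Qed.

Lemma hereditary_ext K K' : (forall P, K P <-> K' P) ->
  hereditary K -> hereditary K'.
Proof.
move=> e [h1 h2 h3 h4 h5 h6]; split.
- move=> P Q; split=> [/e /h1 [/e ? /e ?] //|[/e kP /e kQ]].
  by apply/e/h1.
- by move=> b P Q /e /h2 [/e ? /e ?].
- by move=> P /e /h3 /e.
- by move=> p P Q /e /h4 /e.
- by move=> P /e /h5 /e.
- by move=> l P P' h /e /(h6 _ _ _ h) /e.
Qed.

Lemma sensors_hereditary (L : seq (sensor S)) :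
  hereditary (fun P => {subset sensors P <= L}).
Proof.
apply: (@hereditary_ext (fun P => {subset names prefix_sensors (fun=> [::]) P
  <= L})).
  by move=> P; rewrite sensorsE.
by apply: names_hereditary => // f [].
Qed.

Lemma actuators_hereditary (L : seq (actuator S)) :
  hereditary (fun P => {subset actuators P <= L}).
Proof.
apply: (@hereditary_ext (fun P => {subset names prefix_actuators (fun=> [::])
  P <= L})).
  by move=> P; rewrite actuatorsE.
by apply: names_hereditary => // f [].
Qed.

Lemma pchans_hereditary (L : seq (chan S)) :
  hereditary (fun P => {subset pchans P <= L}).
Proof.
apply: (@hereditary_ext (fun P => {subset names (fun=> [::]) cprefix_chans P
  <= L})).
  by move=> P; rewrite pchansE.
by apply: names_hereditary => // f [].
Qed.

Lemma act_pchans l P P' : act l P P' -> {subset pchans P' <= pchans P}.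
Proof. by move=> h;
  apply: (act_hereditary (pchans_hereditary (pchans P)) h). Qed.

Lemma ptick_pchans P P' : ptick P P' -> {subset pchans P' <= pchans P}.
Proof. by move=> h;
  apply: (ptick_hereditary (pchans_hereditary (pchans P)) h). Qed.

Definition plabel_chan (l : @plabel S) : option (chan S) :=
  match l with POut c _ | PIn c _ => Some c | _ => None end.

Lemma unfold_pchans P : {subset pchans (unfold_fix P) <= pchans P}.
Proof. by apply: (hereditary_fix (pchans_hereditary (pchans P))). Qed.

Lemma act_label_chan l P P' c : act l P P' -> plabel_chan l = Some c ->
  c \in pchans P.
Proof.
move=> h; elim: h c => {l P P'} //=.
- by move=> l P P' [] //= c v A B _ [<-]; rewrite mem_head.
- by move=> l P P' Q _ IH c /IH; rewrite mem_cat => ->.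
- by move=> l P P' Q _ IH c /IH; rewrite mem_cat => ->; rewrite orbT.
- by move=> l P Q _ IH c /IH; apply: unfold_pchans.
- by move=> l b [] P Q P' g _ IH c /IH; rewrite mem_cat => ->; rewrite ?orbT.
Qed.

(** Combined with the well-formedness of interfaces, this shows that an actuator update does not
    enlarge the domain of the interface. *)
Lemma act_write_actuator a v P P' : act (PWrite a v) P P' -> a \in actuators P.
Proof.
move E: (PWrite a v) => l h; elim: h E => {l P P'} //=.
- by move=> l P P' [] //= a' v' A [-> _]; rewrite mem_head.
- by move=> l P P' Q _ IH /IH; rewrite mem_cat => ->.
- by move=> l P P' Q _ IH /IH; rewrite mem_cat => ->; rewrite orbT.
- move=> l P Q _ IH /IH.
  by apply: (hereditary_fix (actuators_hereditary (actuators P))).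
- by move=> l b [] P Q P' g _ IH /IH; rewrite mem_cat => ->; rewrite ?orbT.
Qed.

(** * Closedness and time-guardedness under substitution *)

Lemma closed_vshift n m P : closed_proc n m P -> closed_proc n.+1 m (vshift P).
Proof.
have gen k : closed_proc (k + n) m P ->
    closed_proc (k + n).+1 m (map_terms (@shift_term S) k P).
  elim: P k m => //=.
  - move=> r P IH k m /andP[h1 h2]; rewrite bnd_map; apply/andP; split.
      case: r h1 h2 => //= a [//|i] /= ik _.
      by case: (leqP k i) => // _; apply: leqW.
    by have := IH (bnd r + k) m; rewrite -!addnA addnS; apply.
  - by move=> P IHP Q IHQ k m /andP[/IHP -> /IHQ ->].
  - move=> p P IHP Q IHQ k m /and3P[h1 h2 /IHQ ->].
    rewrite cbnd_map andbT; apply/andP; split.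
      case: p h1 h2 => //= a [//|i] /= ik _.
      by case: (leqP k i) => // _; apply: leqW.
    by have := IHP (cbnd p + k) m; rewrite -!addnA addnS; apply.
  - move=> [s ts] P IHP Q IHQ k m /and3P[h1 /IHP -> /IHQ ->].
    rewrite /= all_map !andbT; apply: sub_all h1 => -[//|i] /= ik.
    by case: (leqP k i) => // _; apply: leqW.
  - by move=> P IH k m; apply: IH.
exact: (gen 0).
Qed.

Lemma closed_vshift_iter i n m P :
  closed_proc n m P -> closed_proc (i + n) m (iter i (@vshift S) P).
Proof. by move=> h; elim: i => //= i IH; apply: closed_vshift. Qed.

Lemma closed_vsubst v n m P : closed_proc n.+1 m P -> closed_proc n m (vsubst
  v P).
Proof.
have gen k : closed_proc (k + n).+1 m P ->
    closed_proc (k + n) m (map_terms (subst_term v) k P).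
  have T j t : closed_term (j + n).+1 t -> closed_term (j + n) (subst_term v j
    t).
    case: t => [//|i] /= ij; case: (ltngtP i j) => //= [ij'|ji].
by rewrite ltn_addr.
    by case: i ij ji.
  elim: P k m => //=.
  - move=> r P IH k m /andP[h1 h2]; rewrite bnd_map; apply/andP; split.
      by case: r h1 h2 => //= a t h _; apply: T.
    by have := IH (bnd r + k) m; rewrite -!addnA -addnS; apply.
  - by move=> P IHP Q IHQ k m /andP[/IHP -> /IHQ ->].
  - move=> p P IHP Q IHQ k m /and3P[h1 h2 /IHQ ->].
    rewrite cbnd_map andbT; apply/andP; split.
      by case: p h1 h2 => //= a t h _; apply: T.
    by have := IHP (cbnd p + k) m; rewrite -!addnA -addnS; apply.
  - move=> [s ts] P IHP Q IHQ k m /and3P[h1 /IHP -> /IHQ ->].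
    by rewrite /= all_map !andbT; apply: sub_all h1 => t; apply: T.
  - by move=> P IH k m; apply: IH.
exact: (gen 0).
Qed.

Lemma closed_pshift n m k P :
  closed_proc n m P -> closed_proc n m.+1 (pshift k P).
Proof.
elim: P n m k => //=.
- by move=> r P IH n m k /andP[-> /IH ->].
- by move=> P IHP Q IHQ n m k /andP[/IHP -> /IHQ ->].
- by move=> p P IHP Q IHQ n m k /and3P[-> /IHP -> /IHQ ->].
- by move=> b P IHP Q IHQ n m k /and3P[-> /IHP -> /IHQ ->].
- by move=> X n m k Xm; case: (leqP k X) => // _; apply: leqW.
- by move=> P IH n m k; apply: IH.
Qed.

Lemma closed_psubst n m k R P : k <= m -> closed_proc n m R ->
  closed_proc n m.+1 P -> closed_proc n m (psubst k R P).
Proof.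
elim: P n m k R => //=.
- move=> r P IH n m k R km hR /andP[-> hP].
  by apply: IH => //; apply: closed_vshift_iter.
- by move=> P IHP Q IHQ n m k R km hR /andP[hP hQ]; rewrite IHP // IHQ.
- move=> p P IHP Q IHQ n m k R km hR /and3P[-> hP hQ]; rewrite IHQ // andbT.
  by apply: IHP => //; apply: closed_vshift_iter.
- by move=> b P IHP Q IHQ n m k R km hR /and3P[-> hP hQ]; rewrite IHP // IHQ.
- move=> X n m k R km hR Xm; case: (ltngtP X k) => //= [Xk|kX].
    exact: leq_trans Xk km.
  by case: X Xm kX.
- by move=> P IH n m k R km hR hP; apply: IH => //; apply: closed_pshift.
Qed.

Lemma closed_hereditary : hereditary (fun P => closed_proc 0 0 P).
Proof.
split=> /=.
- by move=> P Q; split=> /andP.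
- by move=> b P Q /and3P[_ -> ->].
- by move=> P h; apply: closed_psubst.
- by move=> p P Q /and3P[].
- by [].
- move=> l P P' [c v A B|c v A B|s v A|a v A|h A] //=; try exact: closed_vsubst.
    by case/andP.
  by case/andP=> hA _; apply: closed_vsubst.
Qed.

Lemma time_guarded_map_terms f k X P :
  time_guarded X (map_terms f k P) = time_guarded X P.
Proof.
elim: P k X => //=.
- by case=> [||s|a t] P0 IH k X /=; rewrite ?IH.
- by move=> P IHP Q IHQ k X; rewrite IHP IHQ.
- by move=> b P IHP Q IHQ k X; rewrite IHP IHQ.
Qed.

Lemma time_guarded_vshift_iter n X P :
  time_guarded X (iter n (@vshift S) P) = time_guarded X P.
Proof. by elim: n => //= n IH; rewrite time_guarded_map_terms. Qed.

Lemma wf_map_terms f k P : wf_proc (map_terms f k P) = wf_proc P.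
Proof.
elim: P k => //=.
- by move=> P IHP Q IHQ k; rewrite IHP IHQ.
- by move=> p P IHP Q IHQ k; rewrite IHP IHQ.
- by move=> b P IHP Q IHQ k; rewrite IHP IHQ.
- by move=> P IH k; rewrite IH time_guarded_map_terms.
Qed.

Lemma wf_vshift_iter n P : wf_proc (iter n (@vshift S) P) = wf_proc P.
Proof. by elim: n => //= n IH; rewrite wf_map_terms. Qed.

Lemma time_guarded_pshift_fresh k P : time_guarded k (pshift k P).
Proof.
elim: P k => //=.
- by case=> [||s|a t] P0 IH k /=; rewrite ?IH.
- by move=> P IHP Q IHQ k; rewrite IHP IHQ.
- by move=> b P IHP Q IHQ k; rewrite IHP IHQ.
- move=> X k; case: leqP => kX; first by rewrite gtn_eqF.
  by rewrite ltn_eqF.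
Qed.

Lemma time_guarded_pshift X k P : X < k ->
  time_guarded X (pshift k P) = time_guarded X P.
Proof.
elim: P X k => //=.
- by case=> [||s|a t] P0 IH X k Xk /=; rewrite ?IH.
- by move=> P IHP Q IHQ X k Xk; rewrite IHP // IHQ.
- by move=> b P IHP Q IHQ X k Xk; rewrite IHP // IHQ.
- move=> Y X k Xk; case: leqP => // kY.
  by rewrite !gtn_eqF // ?(leq_trans Xk) // leqW // (leq_trans Xk).
- by move=> P IH X k Xk; rewrite IH.
Qed.

Lemma wf_pshift k P : wf_proc P -> wf_proc (pshift k P).
Proof.
elim: P k => //=.
- by move=> P IHP Q IHQ k /andP[/IHP -> /IHQ ->].
- by move=> p P IHP Q IHQ k /andP[/IHP -> /IHQ ->].
- by move=> b P IHP Q IHQ k /andP[/IHP -> /IHQ ->].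
- by move=> P IH k /andP[t /IH ->]; rewrite time_guarded_pshift ?t.
Qed.

Lemma time_guarded_psubst X k R P : X < k -> time_guarded X R ->
  time_guarded X P -> time_guarded X (psubst k R P).
Proof.
(* Crossing a [Fix] raises the observed index and shifts [R] at the same time, so the two changes
   cancel. *)
have shiftS Y T : time_guarded Y.+1 (pshift 0 T) = time_guarded Y T.
  have gen j : j <= Y -> time_guarded Y.+1 (pshift j T) = time_guarded Y T.
    elim: T Y j => //=.
    - by case=> [||s|a t] P0 IH Y j jY /=; rewrite ?IH.
    - by move=> A IHA B IHB Y j jY; rewrite IHA // IHB.
    - by move=> b A IHA B IHB Y j jY; rewrite IHA // IHB.
    - move=> Z Y j jY; case: leqP => // Zj.
      by rewrite !ltn_eqF // ?leqW // (leq_trans Zj).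
    - by move=> A IH Y j jY; rewrite IH.
  exact: gen.
elim: P X k R => //=.
- case=> [||s|a t] P IH X k R Xk hR //= hP; apply: IH => //.
  + by rewrite time_guarded_map_terms.
  + by rewrite time_guarded_map_terms.
- by move=> P IHP Q IHQ X k R Xk hR /andP[hP hQ]; rewrite IHP // IHQ.
- move=> p P IHP Q IHQ X k R Xk hR hP; apply: IHP => //.
  by rewrite time_guarded_vshift_iter.
- by move=> b P IHP Q IHQ X k R Xk hR /andP[hP hQ]; rewrite IHP // IHQ.
- move=> Y X k R Xk hR YX; case: (ltngtP Y k) => //= kY.
  by case: Y kY {YX} => //= Y kY; rewrite gtn_eqF // (leq_trans Xk).
- by move=> P IH X k R Xk hR hP; apply: IH => //; rewrite shiftS.
Qed.

Lemma wf_psubst k R P : wf_proc R -> wf_proc P -> wf_proc (psubst k R P).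
Proof.
elim: P k R => //=.
- by move=> r P IH k R hR hP; apply: IH => //; rewrite wf_vshift_iter.
- by move=> P IHP Q IHQ k R hR /andP[hP hQ]; rewrite IHP // IHQ.
- move=> p P IHP Q IHQ k R hR /andP[hP hQ]; rewrite IHQ // andbT.
  by apply: IHP => //; rewrite wf_vshift_iter.
- by move=> b P IHP Q IHQ k R hR /andP[hP hQ]; rewrite IHP // IHQ.
- by move=> X k R hR _; case: eqP.
- move=> P IH k R hR /andP[t hP]; apply/andP; split.
    (* The variable bound by this [Fix] has index 0, below the substituted index, and the shifted
       [R] does not contain it. *)
    by apply: time_guarded_psubst => //; apply: time_guarded_pshift_fresh.
  by apply: IH => //; apply: wf_pshift.
Qed.

Lemma wf_hereditary : hereditary (fun P => wf_proc P).
Proof.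
split=> /=.
- by move=> P Q; split=> /andP.
- by move=> b P Q /andP.
- by move=> P h; apply: wf_psubst => //; case/andP: h.
- by move=> p P Q /andP[].
- by [].
- by move=> l P P' [c v A B|c v A B|s v A|a v A|h A] //=;
    rewrite ?wf_map_terms //;
    case/andP.
Qed.

End Names.

(** * Renaming of channels in processes *)

Section ChannelRenaming.

Context {S : signature}.
Implicit Types (P Q R T : proc S) (f g : chan S -> chan S).

Lemma map_chan_map_terms f u k P :
  map_chan f (map_terms u k P) = map_terms u k (map_chan f P).
Proof.
elim: P k => //=.
- by move=> r P IH k; rewrite IH.
- by move=> P IHP Q IHQ k; rewrite IHP IHQ.
- by move=> [c t|c] P IHP Q IHQ k /=; rewrite IHP IHQ.
- by move=> b P IHP Q IHQ k; rewrite IHP IHQ.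
- by move=> P IH k; rewrite IH.
Qed.

Lemma map_chan_vshift_iter f n P :
  map_chan f (iter n (@vshift S) P) = iter n (@vshift S) (map_chan f P).
Proof. by elim: n => //= n IH; rewrite map_chan_map_terms IH. Qed.

Lemma map_chan_pshift f k P : map_chan f (pshift k P) = pshift k (map_chan f P).
Proof.
elim: P k => //=.
- by move=> r P IH k; rewrite IH.
- by move=> P IHP Q IHQ k; rewrite IHP IHQ.
- by move=> [c t|c] P IHP Q IHQ k /=; rewrite IHP IHQ.
- by move=> b P IHP Q IHQ k; rewrite IHP IHQ.
- by move=> P IH k; rewrite IH.
Qed.

Lemma map_chan_psubst f k R P :
  map_chan f (psubst k R P) = psubst k (map_chan f R) (map_chan f P).
Proof.
elim: P k R => //=.
- by move=> r P IH k R; rewrite IH map_chan_vshift_iter.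
- by move=> P IHP Q IHQ k R; rewrite IHP IHQ.
- by move=> [c t|c] P IHP Q IHQ k R /=; rewrite IHP IHQ ?map_chan_map_terms.
- by move=> b P IHP Q IHQ k R; rewrite IHP IHQ.
- by move=> X k R; case: eqP.
- by move=> P IH k R; rewrite IH map_chan_pshift.
Qed.

Lemma map_chan_unfold f P :
  map_chan f (unfold_fix P) = unfold_fix (map_chan f P).
Proof. exact: map_chan_psubst. Qed.

(** Also valid when [f] merges channels; the erasure of bound channels to a constant relies on
    that. *)
Lemma pcong_map_chan f P Q : pcong P Q -> pcong (map_chan f P) (map_chan f Q).
Proof.
elim=> {P Q} /=; try by eauto using @pcong.
- by move=> [c t|c] P P' Q Q' _ hP _ hQ; apply: pcong_timeout.
- by move=> P; rewrite map_chan_unfold; apply: pcong_unfold.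
Qed.

Lemma pchans_map_chan f P : pchans (map_chan f P) = map f (pchans P).
Proof.
elim: P => //=.
- by move=> P -> Q ->; rewrite map_cat.
- by move=> [c t|c] P IHP Q IHQ /=; rewrite IHP IHQ map_cat.
- by move=> b P -> Q ->; rewrite map_cat.
Qed.

Lemma eq_map_chan f g P : {in pchans P, f =1 g} -> map_chan f P = map_chan g P.
Proof.
have catP (s t : seq (chan S)) :
    {in s ++ t, f =1 g} -> {in s, f =1 g} /\ {in t, f =1 g}.
  by move=> h; split=> x xs; apply: h; rewrite mem_cat xs ?orbT.
elim: P => //=.
- by move=> r P IH h; rewrite IH.
- by move=> P IHP Q IHQ /catP [/IHP -> /IHQ ->].
- move=> [c t|c] P IHP Q IHQ h /=; rewrite h ?mem_head //;
    have /catP [/IHP -> /IHQ ->] // : {in pchans P ++ pchans Q, f =1 g};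
    by move=> x xs; apply: h; rewrite inE xs orbT.
- by move=> b P IHP Q IHQ /catP [/IHP -> /IHQ ->].
- by move=> P IH h; rewrite IH.
Qed.

Lemma map_chan_comp f g P : map_chan f (map_chan g P) = map_chan (f \o g) P.
Proof.
elim: P => //=.
- by move=> r P ->.
- by move=> P -> Q ->.
- by move=> [c t|c] P IHP Q IHQ /=; rewrite IHP IHQ.
- by move=> b P -> Q ->.
- by move=> P ->.
Qed.

Lemma map_chan_id P : map_chan id P = P.
Proof.
elim: P => //=.
- by move=> r P ->.
- by move=> P -> Q ->.
- by move=> [c t|c] P IHP Q IHQ /=; rewrite IHP IHQ.
- by move=> b P -> Q ->.
- by move=> P ->.
Qed.

Definition map_plabel f (l : @plabel S) : @plabel S :=
  match l with
  | POut c v => POut (f c) v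
  | PIn c v => PIn (f c) v
  | _ => l
  end.

Lemma act_map_chan f l P P' : (forall c, rng (f c) = rng c) -> act l P P' ->
  act (map_plabel f l) (map_chan f P) (map_chan f P').
Proof.
move=> F; elim=> {l P P'} /=; try by eauto using @act.
- move=> l P P' [c v A B|c v A B|s v A|a v A|h A] /=; apply: act_head;
  rewrite ?map_chan_map_terms; constructor.
- move=> l1 l2 P P' Q Q' s _ hP _ hQ; apply: act_com hP hQ.
  by case: l1 l2 s => [|c v|c v|h|s v|a v] [|c' v'|c' v'|h'|s' v'|a' v'] //=;
    case=> -> -> <-.
- by move=> l P Q _ h; apply: act_fix; rewrite -map_chan_unfold.
- by move=> l b r P Q P' g _ h; apply: act_ite g _; move: h; case: (r).
Qed.

(** A tau-step of the renamed process is renamed back by the involution. A renaming that merges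
    channels could create a communication. *)
Lemma quiet_map_chan f P : involutive f -> (forall c, rng (f c) = rng c) ->
  quiet P -> quiet (map_chan f P).
Proof.
move=> fK F q [R /(act_map_chan F) /= h]; apply: q; exists (map_chan f R).
move: h; rewrite map_chan_comp (@eq_map_chan _ id) ?map_chan_id // => c _.
exact: fK.
Qed.

Lemma ptick_map_chan f P P' : involutive f -> (forall c, rng (f c) = rng c) ->
  ptick P P' -> ptick (map_chan f P) (map_chan f P').
Proof.
move=> fK F; elim=> {P P'} /=; try by eauto using @ptick.
- by move=> [c t|c] P Q; apply: ptick_timeout.
- move=> P P' Q Q' _ hP _ hQ /quietP q; apply: tick_par => //.
  exact: (quiet_map_chan (P := Par P Q)).
- by move=> P Q _ h; apply: ptick_fix; rewrite -map_chan_unfold.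
Qed.

End ChannelRenaming.

(** * Structural congruence is a bisimulation for instantaneous network transitions *)

Section NetworkTransitions.

Context {S : signature}.
Implicit Types (P Q : proc S) (M N O : net S) (I J : iface S) (h k : loc S).

(** Tabulates process label, network label and updated interface, so that the rules for a node
    become one constructor of [itr]. *)
Inductive node_label h I : @plabel S -> @nlabel S -> iface S -> Prop :=
  | node_pos : node_label h I (PPos h) (NInst (@Tau S)) I
  | node_read s v : isens I s = Some v ->
      node_label h I (PRead s v) (NInst (@Tau S)) I
  | node_unchg a v : iact I a = Some v ->
      node_label h I (PWrite a v) (NInst (@Tau S)) I
  | node_chg a v : iact I a <> Some v ->
      node_label h I (PWrite a v) (NInst (Act a)) (iupd I a v)
  | node_tau : node_label h I (@PTau S) (NInst (@Tau S)) I
  | node_out c v : le_range 0 (rng c) ->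
      node_label h I (POut c v) (NOut c v h) I
  | node_in c v : le_range 0 (rng c) ->
      node_label h I (PIn c v) (NIn c v h) I.

Definition nsync (l1 l2 : @nlabel S) : Prop :=
  match l1, l2 with
  | NOut c v k, NIn c' v' h | NIn c v h, NOut c' v' k =>
      [/\ c = c', v = v' & le_range (dist h k) (rng c)]
  | _, _ => False
  end.

Inductive itr : @nlabel S -> net S -> net S -> Prop :=
  | itr_node pl l n I I' P P' mu h :
      node_label h I pl l I' -> act pl P P' ->
      itr l (Node n I P mu h) (Node n I' P' mu h)
  | itr_com l1 l2 M M' N N' : nsync l1 l2 ->
      itr l1 M M' -> itr l2 N N' -> itr (NInst (@Tau S)) (NPar M N) (NPar M' N')
  | itr_parl l M M' N : itr l M M' -> itr l (NPar M N) (NPar M' N)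
  | itr_parr l M M' N : itr l M M' -> itr l (NPar N M) (NPar N M')
  | itr_res l c M N : itr l M N -> nlabel_chan l <> Some c ->
      itr l (Res c M) (Res c N).

Lemma nsyncC l1 l2 : nsync l1 l2 -> nsync l2 l1.
Proof. by case: l1 l2 => [u|c v k|c v k] [u'|c' v' k'|c' v' k'] //= [<- <-].
  Qed.

Lemma nsync_chan l1 l2 : nsync l1 l2 -> nlabel_chan l1 = nlabel_chan l2.
Proof. by case: l1 l2 => [u|c v k|c v k] [u'|c' v' k'|c' v' k'] //= [<-]. Qed.

Lemma itrP l M M' : itrans l M M' <-> itr l M M'.
Proof.
split; elim=> {l M M'}; try by eauto using itr.
- by move=> n I P P' mu h /actP; apply: itr_node; constructor.
- by move=> n I s v P P' mu h e /actP; apply: itr_node; constructor.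
- by move=> n I s v P P' mu h e /actP; apply: itr_node; constructor.
- by move=> n I s v P P' mu h e /actP; apply: itr_node; constructor.
- by move=> n I P P' mu h /actP; apply: itr_node; constructor.
- by move=> n I c v P P' mu h /actP h1 e; apply: itr_node h1; constructor.
- by move=> n I c v P P' mu h /actP h1 e; apply: itr_node h1; constructor.
- move=> c v h k M M' N N' _ h1 _ h2 e.
  by apply: (@itr_com (NOut c v k) (NIn c v h)).
- move=> c v h k M M' N N' _ h1 _ h2 e.
  by apply: (@itr_com (NIn c v h) (NOut c v k)).
- move=> pl l n I I' P P' mu h [|s v e|a v e|a v e||c v e|c v e] /actP hP.
  + exact: itrans_pos.
  + exact: itrans_sensread e hP.
  + exact: itrans_actunchg e hP.
  + exact: itrans_actchg e hP.
  + exact: itrans_loccom.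
  + exact: itrans_out.
  + exact: itrans_in.
- move=> [u|c v k|c v k] [u'|c' v' k'|c' v' k'] M M' N N' //= [<- <- e] _ h1 _
    h2.
    exact: itrans_glbcoml h1 h2 e.
  exact: itrans_glbcomr h2 h1 e.
- by move=> l M M' N _; apply: itrans_parl.
- by move=> l M M' N _; apply: itrans_parr.
- by move=> l c M N _; apply: itrans_res.
Qed.

Lemma itr_inv l M M' : itr l M M' ->
  match M with
  | Zero => False
  | Node n J P mu h => exists pl J' P',
      [/\ node_label h J pl l J', act pl P P' & M' = Node n J' P' mu h]
  | NPar M N =>
      [\/ exists2 M1, itr l M M1 & M' = NPar M1 N,
          exists2 N1, itr l N N1 & M' = NPar M N1
        | l = NInst (@Tau S) /\ exists l1 l2 M1 N1,
            [/\ nsync l1 l2, itr l1 M M1, itr l2 N N1 & M' = NPar M1 N1]]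
  | Res c M => exists M1, [/\ itr l M M1, nlabel_chan l <> Some c & M' = Res c
    M1]
  end.
Proof.
case=> {l M M'}.
- by move=> pl l n I I' P P' mu h e hP; exists pl, I', P'.
- by move=> l1 l2 M M' N N' s h1 h2; constructor 3; split=> //;
    exists l1, l2, M', N'.
- by move=> l M M' N h; constructor 1; exists M'.
- by move=> l M M' N h; constructor 2; exists M'.
- by move=> l c M N h e; exists N.
Qed.

Lemma itr_free_chans l M M' : itr l M M' ->
  {subset free_chans M' <= free_chans M}.
Proof.
elim=> {l M M'} /=.
- by move=> pl l n I I' P P' mu h _; apply: act_pchans.
- move=> l1 l2 M M' N N' _ _ hM _ hN x; rewrite !mem_cat.
  by case/orP=> [/hM ->|/hN ->]; rewrite ?orbT.
- move=> l M M' N _ hM x; rewrite !mem_cat.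
  by case/orP=> [/hM ->|->]; rewrite ?orbT.
- move=> l M M' N _ hM x; rewrite !mem_cat.
  by case/orP=> [->|/hM ->]; rewrite ?orbT.
- by move=> l c M N _ hM _ x; rewrite !mem_filter => /andP[-> /hM].
Qed.

(** Used contrapositively: a channel fresh for a network labels none of its transitions, as scope
    extrusion and alpha-conversion require. *)
Lemma itr_label_chan l M M' c : itr l M M' -> nlabel_chan l = Some c ->
  c \in free_chans M.
Proof.
move=> h; elim: h c => {l M M'} //=.
- move=> pl l n I I' P P' mu h e /act_label_chan hP c.
  by case: e hP => //= c' v _ hP ec; apply: hP.
- by move=> l M M' N _ hM c /hM; rewrite mem_cat => ->.
- by move=> l M M' N _ hM c /hM; rewrite mem_cat orbC => ->.
- move=> l c M N _ hM nc d e; rewrite mem_filter hM // andbT.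
  by apply/eqP=> E; apply: nc; rewrite e E.
Qed.

Lemma swapK c d : involutive (@swap S c d).
Proof.
move=> e; rewrite /swap; case: (eqVneq e c) => [->|ec].
  by rewrite eqxx; case: eqP.
case: (eqVneq e d) => [->|ed]; first by rewrite eqxx.
by rewrite (negbTE ec) (negbTE ed).
Qed.

Lemma swapL c d : @swap S c d c = d. Proof. by rewrite /swap eqxx. Qed.

Lemma swapN c d e : e != c -> e != d -> @swap S c d e = e.
Proof. by move=> /negbTE ec /negbTE ed; rewrite /swap ec ed. Qed.

Lemma swapC c d : @swap S c d =1 swap d c.
Proof.
move=> e; rewrite /swap; case: (eqVneq e c) => [->|_].
  by case: eqP.
by case: (eqVneq e d).
Qed.

Lemma rng_swap c d e : rng d = rng c -> rng (@swap S c d e) = rng e.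
Proof. by move=> E; rewrite /swap; case: eqP => [->|_] //;
  case: eqP => [->|]. Qed.

Lemma swap_netC c d M : swap_net c d M = swap_net d c M.
Proof.
elim: M => //= [n I P mu h|M -> N -> //|e M ->]; last by rewrite swapC.
by congr Node; apply: eq_map_chan => x _; apply: swapC.
Qed.

Lemma swap_netK c d M : swap_net c d (swap_net c d M) = M.
Proof.
elim: M => //= [n I P mu h|M -> N -> //|e M ->]; last by rewrite swapK.
congr Node; rewrite map_chan_comp (@eq_map_chan _ _ id) ?map_chan_id // => x _.
exact: swapK.
Qed.

Lemma free_chans_swap c d M :
  free_chans (swap_net c d M) = map (swap c d) (free_chans M).
Proof.
elim: M => //= [n I P mu h|M -> N ->|e M ->].
- exact: pchans_map_chan.
- by rewrite map_cat.
- rewrite filter_map; congr map; apply: eq_filter => x /=.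
  by rewrite (inj_eq (inv_inj (@swapK c d))).
Qed.

Lemma swap_free_chans c d e M :
  (e \in free_chans (swap_net c d M)) = (swap c d e \in free_chans M).
Proof.
by rewrite free_chans_swap -{1}[e](@swapK c d) mem_map //;
  apply: inv_inj (@swapK c d).
Qed.

Definition swap_nlabel c d (l : @nlabel S) : @nlabel S :=
  match l with
  | NInst _ => l
  | NOut e v h => NOut (swap c d e) v h
  | NIn e v h => NIn (swap c d e) v h
  end.

Lemma itr_swap c d l M M' : rng d = rng c -> itr l M M' ->
  itr (swap_nlabel c d l) (swap_net c d M) (swap_net c d M').
Proof.
move=> E; have F e := rng_swap e E; elim=> {l M M'} /=; try by eauto using itr.
- move=> pl l n I I' P P' mu h e /(act_map_chan F) hP.
  by apply: itr_node hP; case: e => //= *; constructor; rewrite ?F.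
- move=> l1 l2 M M' N N' s _ hM _ hN; apply: itr_com hM hN.
  by case: l1 l2 s => [u|e v k|e v k] [u'|e' v' k'|e' v' k'] //= [<- <-];
    split=> //; rewrite F.
- move=> l e M N _ h nc; apply: itr_res => //.
  by case: l nc {h} => //= e' v k nc [/(inv_inj (@swapK c d)) E']; apply: nc;
    rewrite E'.
Qed.

Lemma swap_nlabel_fresh c d l : nlabel_chan l <> Some c -> nlabel_chan l <>
  Some d ->
  swap_nlabel c d l = l.
Proof.
by case: l => //= e v h nc nd; rewrite swapN //; apply/eqP=> E;
  rewrite E in nc nd.
Qed.

Definition nsim M N := forall l M1, itr l M M1 ->
  exists2 N1, itr l N N1 & ncong M1 N1.

Lemma nsim_trans M N O : nsim M N -> nsim N O -> nsim M O.
Proof.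
move=> h h' l M1 /h [N1 /h' [O1 hO e'] e].
by exists O1 => //; apply: ncong_trans e e'.
Qed.

Lemma nsim_parC M N : nsim (NPar M N) (NPar N M).
Proof.
move=> l T /itr_inv [[M1 hM ->]|[N1 hN ->]|[-> [l1 [l2 [M1 [N1 [s hM hN
  ->]]]]]]].
- by exists (NPar N M1); [apply: itr_parr|apply: ncong_parC].
- by exists (NPar N1 M); [apply: itr_parl|apply: ncong_parC].
- by exists (NPar N1 M1); [apply: itr_com (nsyncC s) hN hM|apply: ncong_parC].
Qed.

Lemma nsim_parA M N O : nsim (NPar (NPar M N) O) (NPar M (NPar N O)).
Proof.
move=> l T /itr_inv [[T1 /itr_inv hT ->]|[O1 hO ->]|[-> [l1 [l2 [T1 [O1 [s hT
  hO ->]]]]]]].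
- case: hT => [[M1 hM ->]|[N1 hN ->]|[-> [l1 [l2 [M1 [N1 [s hM hN ->]]]]]]].
  + by exists (NPar M1 (NPar N O)); [apply: itr_parl|apply: ncong_parA].
  + by exists (NPar M (NPar N1 O)); [apply/itr_parr/itr_parl|apply: ncong_parA].
  + exists (NPar M1 (NPar N1 O)); last exact: ncong_parA.
    by apply: itr_com s hM _; apply: itr_parl.
- by exists (NPar M (NPar N O1)); [apply/itr_parr/itr_parr|apply: ncong_parA].
- case/itr_inv: hT => [[M1 hM ->]|[N1 hN ->]|[E _]]; last by rewrite E in s.
  + exists (NPar M1 (NPar N O1)); last exact: ncong_parA.
    by apply: itr_com s hM _; apply: itr_parr.
  + exists (NPar M (NPar N1 O1)); last exact: ncong_parA.
    by apply: itr_parr; apply: itr_com s hN hO.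
Qed.

Lemma nsim_parA' M N O : nsim (NPar M (NPar N O)) (NPar (NPar M N) O).
Proof.
apply: nsim_trans (@nsim_parC _ _) _; apply: nsim_trans (@nsim_parA _ _ _) _.
apply: nsim_trans (@nsim_parC _ _) _; apply: nsim_trans (@nsim_parA _ _ _) _.
exact: nsim_parC.
Qed.

Lemma nsim_par M M' N N' : ncong M M' -> ncong N N' ->
  nsim M M' -> nsim N N' -> nsim (NPar M N) (NPar M' N').
Proof.
move=> eM eN sM sN l T.
move=> /itr_inv [[M1 /sM [M2 hM e] ->]|[N1 /sN [N2 hN e] ->]|].
- by exists (NPar M2 N'); [apply: itr_parl|apply: ncong_par].
- by exists (NPar M' N2); [apply: itr_parr|apply: ncong_par].
- move=> [-> [l1 [l2 [M1 [N1 [s /sM [M2 hM e] /sN [N2 hN e'] ->]]]]]].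
  by exists (NPar M2 N2); [apply: itr_com s hM hN|apply: ncong_par].
Qed.

Lemma nsim_res c M N : nsim M N -> nsim (Res c M) (Res c N).
Proof.
move=> s l T /itr_inv [M1 [/s [N1 hN e] nc ->]].
by exists (Res c N1); [apply: itr_res|apply: ncong_res].
Qed.

(** The channel of the label is not [c], by the rule for restriction, nor [d], by freshness; hence
    the swap leaves the label unchanged. *)
Lemma nsim_alpha c d M : d \notin free_chans M -> rng d = rng c ->
  nsim (Res c M) (Res d (swap_net c d M)).
Proof.
move=> dM E l T /itr_inv [M1 [h nc ->]].
have nd : nlabel_chan l <> Some d by move=> /(itr_label_chan h); apply/negP.
exists (Res d (swap_net c d M1)).
  by apply: itr_res => //; rewrite -(swap_nlabel_fresh nc nd); apply: itr_swap.
by apply: ncong_alpha => //; apply: contraNN dM; apply: itr_free_chans h _.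
Qed.

(** No network rule duplicates a subterm, so induction on the congruence derivation works here. Both
    directions are carried along for the symmetry rule. *)
Lemma ncong_nsim M N : ncong M N -> nsim M N /\ nsim N M.
Proof.
elim=> {M N}.
- by move=> M; split=> l M1 h; exists M1 => //; apply: ncong_refl.
- by move=> M N _ [].
- by move=> M N O _ [h1 h2] _ [h3 h4]; split;
    [apply: nsim_trans h1 h3|apply: nsim_trans h4 h2].
- have node n I P Q mu h : pcong P Q -> nsim (Node n I P mu h) (Node n I Q mu
    h).
    move=> e l T /itr_inv [pl [I' [P' [hl /(act_pcong e) [Q' hQ e'] ->]]]].
    exists (Node n I' Q' mu h); first exact: itr_node hl hQ.
    exact: ncong_node.
  by move=> n I P Q mu h e; split; apply: node => //; apply: pcong_sym.
- move=> M M' N N' eM [sM sM'] eN [sN sN'].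
  by split; apply: nsim_par => //; apply: ncong_sym.
- by move=> c M M' _ [h h']; split; apply: nsim_res.
- by move=> M N; split; apply: nsim_parC.
- by move=> M N O; split; [apply: nsim_parA|apply: nsim_parA'].
- move=> M; split=> l T.
    move=> /itr_inv [[M1 hM ->]|[N1 /itr_inv []]|[_ [l1 [l2 [M1 [N1 [_ _
      /itr_inv []]]]]]]].
    by exists M1 => //; apply: ncong_par0.
  move=> h; exists (NPar T (@Zero S)); first exact: itr_parl.
  exact: ncong_sym (ncong_par0 _).
- by move=> c; split=> l T /itr_inv // [M1 [/itr_inv]].
- have resC c d M : nsim (Res c (Res d M)) (Res d (Res c M)).
    move=> l T /itr_inv [M1 [/itr_inv [M2 [h nd ->]] nc ->]].
    by exists (Res d (Res c M2)); [do 2!apply: itr_res => //|apply: ncong_resC].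
  by move=> c d M; split; apply: resC.
- move=> c M N cM.
  (* [M] can neither perform a visible action on [c] nor acquire [c] by a step. Hence a
     communication with [N] never uses [c], and the restriction on [N] does not block it. *)
  have fresh l M1 : itr l M M1 -> nlabel_chan l <> Some c.
    by move=> h /(itr_label_chan h); apply/negP.
  have cM1 l M1 : itr l M M1 -> c \notin free_chans M1.
    by move=> h; apply: contraNN cM; apply: itr_free_chans h _.
  split=> l T /itr_inv.
    move=> [T1 [/itr_inv hT nc ->]]; case: hT nc => [[M1 hM ->]|[N1 hN ->]|] nc.
    + exists (NPar M1 (Res c N)); first exact: itr_parl.
      by apply: ncong_extr; apply: cM1 hM.
    + exists (NPar M (Res c N1)); first by apply/itr_parr/itr_res.
      exact: ncong_extr.
    + case: nc => [-> [l1 [l2 [M1 [N1 [s hM hN ->]]]]]] _;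
        exists (NPar M1 (Res c N1)).
        apply: (itr_com s hM); apply: itr_res => // e.
        by apply: (fresh _ _ hM); rewrite (nsync_chan s).
      by apply: ncong_extr; apply: cM1 hM.
  case=> [[M1 hM ->]|[T1 /itr_inv [N1 [hN nc ->]] ->]|].
  + exists (Res c (NPar M1 N)).
      by apply: itr_res (fresh _ _ hM); apply: itr_parl.
    by apply/ncong_sym/ncong_extr; apply: cM1 hM.
  + exists (Res c (NPar M N1)); first by apply: itr_res nc; apply: itr_parr.
    exact/ncong_sym/ncong_extr.
  + move=> [-> [l1 [l2 [M1 [T1 [s hM /itr_inv [N1 [hN nc ->]] ->]]]]]].
    exists (Res c (NPar M1 N1)); first by apply: itr_res => //;
      apply: itr_com s hM hN.
    by apply/ncong_sym/ncong_extr; apply: cM1 hM.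
- move=> c d M dM E; split; first exact: nsim_alpha.
  (* The converse is again an alpha-conversion: the swap is an involution, and [c] is fresh for the
     swapped network because [d] is fresh for [M]. *)
  have {2}-> : M = swap_net d c (swap_net c d M) by rewrite swap_netC swap_netK.
  by apply: nsim_alpha => //; rewrite swap_free_chans swapL.
Qed.

End NetworkTransitions.

(** * Structural congruence is a bisimulation for the passage of time *)

Section TimedTransitions.

Context {S : signature}.
Implicit Types (P Q : proc S) (M N O : net S) (I J : iface S) (h k : loc S).

Definition still M := ~ exists M', itr (NInst (@Tau S)) M M'.

Lemma stillP M : trans_stuck M <-> still M.
Proof. by split=> s [M' /itrP h]; apply: s; exists M'. Qed.

Lemma still_ncong M N : ncong M N -> still M -> still N.
Proof.
move=> /ncong_nsim [_ s] sM [N' /s [M' h _]].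
by apply: sM; exists M'.
Qed.

Definition moves (mu : mobility) h k : Prop :=
  match mu with Stationary => k = h | Mobile => dist h k <= delta S end.

Lemma ttrans_node n I P P' mu h k : ptick P P' -> still (Node n I P mu h) ->
  moves mu h k -> ttrans (Node n I P mu h) (Node n I P' mu k).
Proof.
move=> hP /stillP s; case: mu s => /= s; first by move=> ->;
  apply: ttrans_timestat.
exact: ttrans_timemob.
Qed.

Lemma ttrans_par M M' N N' : ttrans M M' -> ttrans N N' -> still (NPar M N) ->
  ttrans (NPar M N) (NPar M' N').
Proof. by move=> hM hN /stillP; apply: ttrans_timepar. Qed.

Lemma ttrans_inv M M' : ttrans M M' ->
  match M with
  | Zero => M' = Zero
  | Node n J P mu h => exists P' k, [/\ ptick P P', still M, moves mu h k
      & M' = Node n J P' mu k]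
  | NPar M1 N1 => exists M1' N1', [/\ ttrans M1 M1', ttrans N1 N1', still M
      & M' = NPar M1' N1']
  | Res c M => exists2 M1, ttrans M M1 & M' = Res c M1
  end.
Proof.
case=> {M M'}.
- by move=> n I P P' h hP /stillP s; exists P', h.
- by move=> n I P P' h k hP /stillP s d; exists P', k.
- by move=> M M' N N' hM hN /stillP s; exists M', N'.
- by [].
- by move=> c M N h; exists N.
Qed.

(** Provides the stillness premise of the parallel rule when congruence creates a new parallel
    composition, by adding [Zero] or by extruding a scope. *)
Lemma ttrans_still M M' : ttrans M M' -> still M.
Proof.
elim: M M' => [|n J P mu h|M _ N _|c M IH] M' /ttrans_inv.
- by move=> _ [M1 /itr_inv].
- by move=> [P' [k []]].
- by move=> [M1 [N1 []]].
- by move=> [M1 /IH s _] [N1 /itr_inv [M2 [h _ _]]]; apply: s; exists M2.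
Qed.

Lemma ttrans_free_chans M M' : ttrans M M' ->
  {subset free_chans M' <= free_chans M}.
Proof.
elim: M M' => [|n J P mu h|M IHM N IHN|c M IH] M' /ttrans_inv.
- by move=> ->.
- by move=> [P' [k [/ptick_pchans hP _ _ ->]]].
- move=> [M1 [N1 [/IHM hM /IHN hN _ ->]]] x /=; rewrite !mem_cat.
  by case/orP=> [/hM ->|/hN ->]; rewrite ?orbT.
- by move=> [M1 /IH h ->] x /=; rewrite !mem_filter => /andP[-> /h].
Qed.

Lemma still_swap c d M : rng d = rng c -> still M -> still (swap_net c d M).
Proof.
move=> E s [N /(itr_swap E)]; rewrite swap_netK => h.
by apply: s; exists (swap_net c d N).
Qed.

Lemma ttrans_swap c d M M' : rng d = rng c -> ttrans M M' ->
  ttrans (swap_net c d M) (swap_net c d M').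
Proof.
move=> E; elim: M M' => [|n J P mu h|M IHM N IHN|e M IH] M' /ttrans_inv.
- by move=> ->; apply: ttrans_timezero.
- move=> [P' [k [hP /(still_swap E) s m ->]]]; apply: ttrans_node => //.
  by apply: ptick_map_chan hP; [apply: swapK|move=> x; apply: rng_swap].
- move=> [M1 [N1 [/IHM hM /IHN hN /(still_swap E) s ->]]].
  exact: ttrans_par.
- by move=> [M1 /IH h ->]; apply: ttrans_res.
Qed.

Definition tsim M N := forall M1, ttrans M M1 ->
  exists2 N1, ttrans N N1 & ncong M1 N1.

Lemma tsim_trans M N O : tsim M N -> tsim N O -> tsim M O.
Proof.
move=> h h' M1 /h [N1 /h' [O1 hO e'] e].
by exists O1 => //; apply: ncong_trans e e'.
Qed.

Lemma tsim_parC M N : tsim (NPar M N) (NPar N M).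
Proof.
move=> T /ttrans_inv [M1 [N1 [hM hN s ->]]]; exists (NPar N1 M1).
  by apply: ttrans_par => //; apply: still_ncong (ncong_parC _ _) s.
exact: ncong_parC.
Qed.

Lemma tsim_parA M N O : tsim (NPar (NPar M N) O) (NPar M (NPar N O)).
Proof.
move=> T /ttrans_inv [T1 [O1 [/ttrans_inv [M1 [N1 [hM hN _ ->]]] hO s ->]]].
have {}s := still_ncong (ncong_parA _ _ _) s.
exists (NPar M1 (NPar N1 O1)); last exact: ncong_parA.
apply: (ttrans_par hM _ s); apply: ttrans_par => // -[R h]; apply: s.
by exists (NPar M R); apply: itr_parr.
Qed.

Lemma tsim_parA' M N O : tsim (NPar M (NPar N O)) (NPar (NPar M N) O).
Proof.
apply: tsim_trans (@tsim_parC _ _) _; apply: tsim_trans (@tsim_parA _ _ _) _.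
apply: tsim_trans (@tsim_parC _ _) _; apply: tsim_trans (@tsim_parA _ _ _) _.
exact: tsim_parC.
Qed.

Lemma tsim_par M M' N N' : ncong M M' -> ncong N N' ->
  tsim M M' -> tsim N N' -> tsim (NPar M N) (NPar M' N').
Proof.
move=> eM eN sM sN T /ttrans_inv [M1 [N1 [/sM [M2 hM e] /sN [N2 hN e'] s ->]]].
exists (NPar M2 N2); last exact: ncong_par.
by apply: ttrans_par => //; apply: still_ncong s; apply: ncong_par.
Qed.

Lemma tsim_res c M N : tsim M N -> tsim (Res c M) (Res c N).
Proof.
move=> s T /ttrans_inv [M1 /s [N1 hN e] ->].
by exists (Res c N1); [apply: ttrans_res|apply: ncong_res].
Qed.

Lemma tsim_alpha c d M : d \notin free_chans M -> rng d = rng c ->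
  tsim (Res c M) (Res d (swap_net c d M)).
Proof.
move=> dM E T /ttrans_inv [M1 h ->]; exists (Res d (swap_net c d M1)).
  by apply: ttrans_res; apply: ttrans_swap.
by apply: ncong_alpha => //; apply: contraNN dM; apply: ttrans_free_chans h _.
Qed.

(** Stillness is invariant under congruence by the instantaneous bisimulation, so the negative
    premises can be transported and the same induction goes through. *)
Lemma ncong_tsim M N : ncong M N -> tsim M N /\ tsim N M.
Proof.
elim=> {M N}.
- by move=> M; split=> M1 h; exists M1 => //; apply: ncong_refl.
- by move=> M N _ [].
- by move=> M N O _ [h1 h2] _ [h3 h4]; split;
    [apply: tsim_trans h1 h3|apply: tsim_trans h4 h2].
- have node n I P Q mu h : pcong P Q -> tsim (Node n I P mu h) (Node n I Q mu
    h).
    move=> e T /ttrans_inv [P' [k [/(ptick_pcong e) [Q' hQ e'] s m ->]]].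
    exists (Node n I Q' mu k); last exact: ncong_node.
    by apply: ttrans_node => //; apply: still_ncong s; apply: ncong_node.
  by move=> n I P Q mu h e; split; apply: node => //; apply: pcong_sym.
- move=> M M' N N' eM [sM sM'] eN [sN sN'].
  by split; apply: tsim_par => //; apply: ncong_sym.
- by move=> c M M' _ [h h']; split; apply: tsim_res.
- by move=> M N; split; apply: tsim_parC.
- by move=> M N O; split; [apply: tsim_parA|apply: tsim_parA'].
- move=> M; split=> T.
    move=> /ttrans_inv [M1 [N1 [hM /ttrans_inv -> _ ->]]].
    by exists M1 => //; apply: ncong_par0.
  move=> h; exists (NPar T (@Zero S)); last exact: ncong_sym (ncong_par0 _).
  apply: (ttrans_par h (@ttrans_timezero S)).
  exact: still_ncong (ncong_sym (ncong_par0 _)) (ttrans_still h).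
- move=> c; split=> T /ttrans_inv; last first.
    move=> ->; exists (Res c (@Zero S)); last exact/ncong_sym/ncong_res0.
    exact/ttrans_res/ttrans_timezero.
  move=> [M1 /ttrans_inv -> ->]; exists (@Zero S); last exact: ncong_res0.
  exact: ttrans_timezero.
- have resC c d M : tsim (Res c (Res d M)) (Res d (Res c M)).
    move=> T /ttrans_inv [M1 /ttrans_inv [M2 h ->] ->].
    by exists (Res d (Res c M2)); [do 2!apply: ttrans_res|apply: ncong_resC].
  by move=> c d M; split; apply: resC.
- move=> c M N cM.
  have cM1 M1 : ttrans M M1 -> c \notin free_chans M1.
    by move=> h; apply: contraNN cM; apply: ttrans_free_chans h _.
  split=> T hT.
    (* After extrusion the outermost operator is a parallel composition, whose rule demands
       stillness; it is carried over from the restricted source. *)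
    have s := still_ncong (ncong_extr N cM) (ttrans_still hT).
    have [T1 /ttrans_inv [M1 [N1 [hM hN _ ->]]] ->] := ttrans_inv hT.
    exists (NPar M1 (Res c N1)); first by apply: ttrans_par => //;
      apply: ttrans_res.
    by apply: ncong_extr; apply: cM1.
  have s := still_ncong (ncong_sym (ncong_extr N cM)) (ttrans_still hT).
  have [M1 [T1 [hM /ttrans_inv [N1 hN ->] _ ->]]] := ttrans_inv hT.
  exists (Res c (NPar M1 N1)); last by apply/ncong_sym/ncong_extr/cM1.
  apply: ttrans_res; apply: ttrans_par => // -[R h]; apply: s.
  by exists (Res c R); apply: itr_res.
- move=> c d M dM E; split; first exact: tsim_alpha.
  have {2}-> : M = swap_net d c (swap_net c d M) by rewrite swap_netC swap_netK.
  by apply: tsim_alpha => //; rewrite swap_free_chans swapL.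
Qed.

End TimedTransitions.

(** * Matching the nodes of congruent networks, for the rule (parp) *)

Section NodeInvariant.

Context {S : signature}.
Implicit Types (P Q : proc S) (M N O : net S) (I J : iface S) (h k : loc S).

Lemma ncong_node_names M N : ncong M N -> perm_eq (node_names M) (node_names N).
Proof.
elim=> {M N} //=.
- by move=> M N _; rewrite perm_sym.
- by move=> M N O _ h _; apply: perm_trans h.
- by move=> M M' N N' _ h _ h'; apply: perm_cat.
- by move=> M N; rewrite perm_catC.
- by move=> M N O; rewrite catA.
- by move=> M; rewrite cats0.
- move=> c d M _ _; suff -> : node_names (swap_net c d M) = node_names M by [].
  by elim: M => //= M -> N ->.
Qed.

Lemma has_node_name n I P mu h M : has_node n I P mu h M -> n \in node_names M.
Proof.
elim: M => //= [m J Q nu k [-> _ _ _ _]|M IHM N IHN]; first by rewrite mem_head.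
by rewrite mem_cat => -[/IHM ->|/IHN ->]; rewrite ?orbT.
Qed.

Lemma has_node_uniq n I P mu h J Q nu k M : uniq (node_names M) ->
  has_node n I P mu h M -> has_node n J Q nu k M ->
  [/\ I = J, P = Q, mu = nu & h = k].
Proof.
elim: M => //= [m J' Q' nu' k' _ [_ -> -> -> ->] [_ -> -> -> ->]|M IHM N IHN]
  //.
rewrite cat_uniq => /and3P[uM /hasPn d uN].
case=> [h1|h1] [h2|h2]; [exact: IHM| | |exact: IHN].
  by move: (d _ (has_node_name h2)) (has_node_name h1) => /= /negP.
by move: (d _ (has_node_name h1)) (has_node_name h2) => /= /negP.
Qed.

(* The processes of a network with the free channels renamed by [f] and all the
   bound ones sent to a constant channel by [e]. Structural congruence does not
   inspect channels, so this erasure makes the processes invariant up to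
   [pcong] despite scope extrusion and alpha-conversion. *)
Fixpoint erased (e f : chan S -> chan S) n I P mu h M : Prop :=
  match M with
  | Zero => False
  | Node m J Q nu k => Node n I P mu h = Node m J (map_chan f Q) nu k
  | NPar M N => erased e f n I P mu h M \/ erased e f n I P mu h N
  | Res c M => erased e (fun x => if x == c then e c else f x) n I P mu h M
  end.

Lemma eq_erased e f g n I P mu h M : {in free_chans M, f =1 g} ->
  erased e f n I P mu h M -> erased e g n I P mu h M.
Proof.
elim: M f g => //= [m J Q nu k|M IHM N IHN|c M IH] f g E.
- by rewrite (eq_map_chan E).
- by case=> [/(IHM _ g)|/(IHN _ g)] h'; [left|right]; apply: h' => x xM;
    apply: E;
    rewrite mem_cat xM ?orbT.
- apply: IH => x xM; case: eqP => // /eqP xc; apply: E.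
  by rewrite mem_filter xc.
Qed.

(** Swapping acts on bound channels as well, but these are all erased to the same value since [e] is
    constant. *)
Lemma erased_swap e f c d n I P mu h M :
  (forall x y, e x = e y) ->
  erased e f n I P mu h (swap_net c d M) <-> erased e (f \o swap c d) n I P mu
    h M.
Proof.
move=> ec; elim: M f => //= [m J Q nu k|M IHM N IHN|b M IH] f.
- by rewrite map_chan_comp.
- by rewrite IHM IHN.
- rewrite IH; split; apply: eq_erased => x _ /=;
    by rewrite (inj_eq (inv_inj (@swapK S c d))) (ec (swap c d b) b).
Qed.

(** Quantified over [f], because each restriction crossed updates the renaming. *)
Definition erased_sub e M N := forall f n I P mu h,
  erased e f n I P mu h M ->
  exists2 Q, erased e f n I Q mu h N & pcong P Q.

Lemma ncong_erased e M N : (forall x y, e x = e y) -> ncong M N ->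
  erased_sub e M N /\ erased_sub e N M.
Proof.
move=> ec; have refl A B : (forall f n I P mu h,
    erased e f n I P mu h A <-> erased e f n I P mu h B) ->
    erased_sub e A B /\ erased_sub e B A.
  by move=> E; split=> f n I P mu h /E hP; exists P => //; apply: pcong_refl.
elim=> {M N}.
- by move=> M; apply: refl.
- by move=> M N _ [].
- move=> M N O _ [h1 h2] _ [h3 h4]; split=> f n I P mu h.
    move=> /h1 [Q /h3 [R hR E'] E]; exists R => //; exact: pcong_trans E E'.
  move=> /h4 [Q /h2 [R hR E'] E]; exists R => //; exact: pcong_trans E E'.
- move=> m J P Q nu k E; split=> f n I R mu h /= [-> -> -> -> ->];
    [exists (map_chan f Q)|exists (map_chan f P)] => //.
    exact: pcong_map_chan.
  exact/pcong_sym/pcong_map_chan.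
- move=> M M' N N' _ [h1 h2] _ [h3 h4]; split=> f n I R mu h /=.
    by case=> [/h1|/h3] [Q hQ E]; exists Q; auto.
  by case=> [/h2|/h4] [Q hQ E]; exists Q; auto.
- by move=> c M M' _ [h1 h2]; split=> f n I R mu h /=; [move=> /h1|move=> /h2].
- by move=> M N; apply: refl => f n I P mu h /=; tauto.
- by move=> M N O; apply: refl => f n I P mu h /=; tauto.
- by move=> M; apply: refl => f n I P mu h /=; tauto.
- by move=> c; apply: refl.
- move=> c d M; apply: refl => f n I P mu h /=; split; apply: eq_erased => x _;
    by do 2!case: eqP => //; move=> <- <-.
- move=> c M N cM; apply: refl => f n I P mu h /=.
  suff E : erased e (fun x => if x == c then e c else f x) n I P mu h M <->
      erased e f n I P mu h M by tauto.
  by split; apply: eq_erased => x xM; rewrite ifN //;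
    apply: contraNneq cM => <-.
- move=> c d M dM _; apply: refl => f n I P mu h /=; rewrite erased_swap //.
  (* Swapping sends [c] to [d], which is then erased, and [d] itself does not occur in [M]; so both
     renamings agree on the free channels. *)
  have E : {in free_chans M, (fun x => if x == c then e c else f x) =1
      (fun x => if x == d then e d else f x) \o swap c d}.
    move=> x xM /=; have xd : x != d by apply: contraNneq dM => <-.
    rewrite /swap; case: (eqVneq x c) => [_|xc]; first by rewrite eqxx (ec c d).
    by rewrite (negbTE xd) (negbTE xd).
  by split; apply: eq_erased => // x xM; rewrite E.
Qed.

(** Same tree and same node names in the same places, without restrictions: the situation of the two
    products in (parp), which a transition from the first one maintains. *)
Inductive same_shape : net S -> net S -> Prop :=
  | shape_zero : same_shape (@Zero S) (@Zero S)
  | shape_node n I P mu h J Q nu k :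
      same_shape (Node n I P mu h) (Node n J Q nu k)
  | shape_par M M' N N' : same_shape M M' -> same_shape N N' ->
      same_shape (NPar M N) (NPar M' N').

Lemma erased_shape e n I P mu h M N : same_shape M N ->
  (erased e id n I P mu h M <-> has_node n I P mu h M) /\
  (erased e id n I P mu h N <-> has_node n I P mu h N).
Proof.
elim=> {M N} //= [m J Q nu k J' Q' nu' k'|M M' N N' _ [h1 h2] _ [h3 h4]].
  by rewrite !map_chan_id; split; split.
tauto.
Qed.

Fixpoint add_procs (q : nodename S -> proc S) M : net S :=
  match M with
  | Zero => Zero
  | Node n J P mu h => Node n J (Par P (q n)) mu h
  | NPar M N => NPar (add_procs q M) (add_procs q N)
  | Res c M => Res c (add_procs q M)
  end.

Lemma itr_add_procs q l M M' : itr l M M' -> itr l (add_procs q M) (add_procs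
  q M').
Proof.
elim=> {l M M'} /=; try by eauto using @itr.
by move=> pl l n I I' P P' mu h hl hP; apply: itr_node hl _; apply: act_parl.
Qed.

Lemma itr_shape l M M' N : itr l M M' -> same_shape M N -> same_shape M' N.
Proof.
move=> h sh; elim: sh l M' h => {M N}.
- by move=> l M' /itr_inv.
- by move=> n I P mu h J Q nu k l M' /itr_inv [pl [I' [P' [_ _ ->]]]];
    constructor.
- move=> M M' N N' sM IHM sN IHN l T /itr_inv.
  case=> [[M1 /IHM h ->]|[N1 /IHN h ->]|[_ [l1 [l2 [M1 [N1 [_ /IHM h /IHN h'
    ->]]]]]]];
  by constructor.
Qed.

(* Distinct node names are essential here: otherwise a congruence could exchange
   two homonymous nodes, but not the processes added to them. *)
Lemma ncong_add_procs q M N : same_shape M N -> uniq (node_names N) ->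
  ncong M N -> ncong (add_procs q M) (add_procs q N).
Proof.
move=> sh uN e.
have [g gc] : exists g : chan S -> chan S, forall x y, g x = g y.
  (* A constant self-map is used rather than a chosen channel because [chan S] may be empty, in
     which case [id] is vacuously constant. *)
  have [[c _]|nc] := classic (exists c : chan S, True);
    first by exists (fun=> c).
  by exists id => x; case: nc; exists x.
have [hM _] := ncong_erased gc e.
(* Erasure yields a congruent process at a node of [N] with the same name, and uniqueness of names
   identifies it with the node at hand. *)
have H n I P mu h J Q nu k : has_node n I P mu h M ->
    has_node n J Q nu k N -> [/\ I = J, pcong P Q, mu = nu & h = k].
  move=> /(erased_shape g _ _ _ _ _ sh).1 /hM [Q'].
  move=> /(erased_shape g _ _ _ _ _ sh).2 h1 E h2.
  by have [-> <- -> ->] := has_node_uniq uN h1 h2.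
elim: sh H {uN e hM} => {M N} /= [_|n I P mu h J Q nu k H|M M' N N' _ IHM _
  IHN H].
- exact: ncong_refl.
- have [-> E -> ->] := H _ _ _ _ _ _ _ _ _ erefl erefl.
  by apply: ncong_node; apply: pcong_par E (pcong_refl _).
- by apply: ncong_par; [apply: IHM|apply: IHN] => *; apply: H; eauto.
Qed.

End NodeInvariant.

(** * The two inclusions between reductions and transitions *)

Section Correspondence.

Context {S : signature}.
Implicit Types (M N O : net S).

Lemma uniq_map_inj (T U : eqType) (f : T -> U) (s : seq T) :
  uniq (map f s) -> {in s &, injective f}.
Proof.
elim: s => //= x s IH /andP[fx us] y z; rewrite !inE.
case/predU1P=> [->|ys] /predU1P[->|zs] // E; last exact: IH.
  by rewrite E map_f in fx.
by rewrite -E map_f in fx.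
Qed.

Lemma node_names_prod p (n : 'I_p -> nodename S) I P mu h :
  node_names (\big[@NPar S/@Zero S]_(i < p) Node (n i) (I i) (P i) (mu i) (h i))
  = map n (index_enum 'I_p).
Proof. by elim: (index_enum _) => [|i s IH];
  rewrite ?big_nil ?big_cons //= IH. Qed.

Lemma same_shape_prod p (n : 'I_p -> nodename S) I P mu h J Q nu k :
  same_shape
    (\big[@NPar S/@Zero S]_(i < p) Node (n i) (I i) (P i) (mu i) (h i))
    (\big[@NPar S/@Zero S]_(i < p) Node (n i) (J i) (Q i) (nu i) (k i)).
Proof. by apply: big_ind2 => *; constructor. Qed.

Lemma add_procs_prod q p (n : 'I_p -> nodename S) I P Q mu h :
  (forall i, q (n i) = Q i) ->
  add_procs q (\big[@NPar S/@Zero S]_(i < p) Node (n i) (I i) (P i) (mu i) (h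
    i))
  = \big[@NPar S/@Zero S]_(i < p) Node (n i) (I i) (Par (P i) (Q i)) (mu i) (h
    i).
Proof.
move=> E; rewrite (big_morph (add_procs q) (id1 := @Zero S) (op1 := @NPar S))
  //.
by apply: eq_bigr => i _ /=; rewrite E.
Qed.

Implicit Types (P Q R : proc S) (I J : iface S) (h k : loc S).

(** Uniqueness of names passes through (struct) because congruence only permutes node names; it is
    consumed in the case of (parp). *)
Lemma ired_itr w M M' : uniq (node_names M) -> ired w M M' ->
  exists2 M'', itr (NInst w) M M'' & ncong M'' M'.
Proof.
move=> uM hM; elim: hM uM => {w M M'}.
- move=> n I P mu h _; eexists; last exact: ncong_refl.
  by apply: itr_node (node_pos _ _) _; apply/act_head/head_pos.
- move=> n I s v P mu h e _; eexists; last exact: ncong_refl.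
  by apply: itr_node (node_read _ e) _; apply/act_head/head_read.
- move=> n I a v P mu h e _; eexists; last exact: ncong_refl.
  by apply: itr_node (node_unchg _ e) _; apply/act_head/head_write.
- move=> n I a v P mu h e _; eexists; last exact: ncong_refl.
  by apply: itr_node (node_chg _ e) _; apply/act_head/head_write.
- move=> n I c v P Q R T mu h e _; eexists; last exact: ncong_refl.
  apply: itr_node (node_tau _ _) _.
  by apply: (@act_com _ (POut c v) (PIn c v)); first split=> //;
    apply: act_head; constructor.
- move=> n I m J c v P Q R T mu1 mu2 h k e _; eexists; last exact: ncong_refl.
  have e0 : le_range 0 (rng c) by case: (rng c) e.
  apply: (@itr_com _ (NOut c v h) (NIn c v k)).
  + by split=> //; rewrite dist_sym.
  + by apply: itr_node (node_out _ _ _ e0) _; apply/act_head/head_out.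
  + by apply: itr_node (node_in _ _ _ e0) _; apply/act_head/head_in.
- move=> w p n I I' P P' Q mu mu' h h' _ IH.
  rewrite node_names_prod => uN; have nI := uniq_map_inj uN.
  have [|M'' hM e] := IH; first by rewrite node_names_prod.
  (* The added processes are indexed by position, whereas [add_procs] selects them by node name;
     names outside the product receive [Nil]. *)
  pose q m := if [pick i | n i == m] is Some i then Q i else @Nil S.
  have qE i : q (n i) = Q i.
    rewrite /q; case: pickP => [j /eqP E|/(_ i)]; last by rewrite eqxx.
    by congr Q; apply: nI E; rewrite mem_index_enum.
  exists (add_procs q M''); first by rewrite -(add_procs_prod _ _ _ _ qE);
    apply: itr_add_procs.
  rewrite -(add_procs_prod _ _ _ _ qE); apply: ncong_add_procs e.
    by apply: itr_shape hM _; apply: same_shape_prod.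
  by rewrite node_names_prod.
- move=> w M M' N _ IH /=; rewrite cat_uniq => /and3P[/IH [M'' h e] _ _].
  exists (NPar M'' N); first exact: itr_parl.
  exact: ncong_par e (ncong_refl _).
- move=> w c M N _ IH /= /IH [M'' h e]; exists (Res c M'');
    first exact: itr_res.
  exact: ncong_res.
- move=> w M N N' M' e _ IH e' uM.
  have [|N'' hN e''] := IH; first by rewrite -(perm_uniq (ncong_node_names e)).
  have [M'' hM e3] := (ncong_nsim e).2 _ _ hN.
  exists M'' => //; apply: ncong_trans (ncong_sym e3) _.
  exact: ncong_trans e'' e'.
Qed.

Lemma still_red_stuck M : uniq (node_names M) -> still M -> red_stuck M.
Proof. by move=> uM s [M' /(ired_itr uM) [M'' h _]]; apply: s; exists M''. Qed.

Lemma ired_add1 w n I P I' P' Q mu h mu' h' :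
  ired w (Node n I P mu h) (Node n I' P' mu' h') ->
  ired w (Node n I (Par P Q) mu h) (Node n I' (Par P' Q) mu' h').
Proof.
have one (F : 'I_1 -> net S) : ncong (F ord0) (\big[@NPar S/@Zero S]_(i < 1) F
  i).
  by rewrite big_ord_recl big_ord0; apply/ncong_sym/ncong_par0.
move=> r; apply: ired_struct
  (one (fun=> Node n I (Par P Q) mu h)) _
  (ncong_sym (one (fun=> Node n I' (Par P' Q) mu' h'))).
apply: (@ired_parp _ _ 1 (fun=> n) (fun=> I) (fun=> I') (fun=> P) (fun=> P')
  (fun=> Q) (fun=> mu) (fun=> mu') (fun=> h) (fun=> h')).
exact: ired_struct (ncong_sym (one (fun=> Node n I P mu h))) r
  (one (fun=> Node n I' P' mu' h')).
Qed.

(** The rule (parp) for a product of two nodes, up to the trailing [Zero]. It adds contexts to a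
    sender and a receiver located in different nodes. *)
Lemma ired_add2 w n I P I' P' Q mu h m J R J' R' T nu k :
  ired w (NPar (Node n I P mu h) (Node m J R nu k))
         (NPar (Node n I' P' mu h) (Node m J' R' nu k)) ->
  ired w (NPar (Node n I (Par P Q) mu h) (Node m J (Par R T) nu k))
         (NPar (Node n I' (Par P' Q) mu h) (Node m J' (Par R' T) nu k)).
Proof.
pose two A (x y : A) (i : 'I_2) := if i == ord0 then x else y.
have prod (F : 'I_2 -> net S) :
    ncong (NPar (F ord0) (F ord_max)) (\big[@NPar S/@Zero S]_(i < 2) F i).
  rewrite !big_ord_recl big_ord0.
  have -> : lift ord0 ord0 = ord_max :> 'I_2 by apply: val_inj.
  by apply: ncong_par (ncong_refl _) (ncong_sym (ncong_par0 _)).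
pose prodE K A B L C D := prod (fun i => Node (two _ n m i) (two _ K L i)
  (Par (two _ A C i) (two _ B D i)) (two _ mu nu i) (two _ h k i)).
pose prodF K A L C := prod (fun i => Node (two _ n m i) (two _ K L i)
  (two _ A C i) (two _ mu nu i) (two _ h k i)).
move=> r; apply: ired_struct (prodE I P Q J R T) _ (ncong_sym (prodE I' P' Q
  J' R' T)).
apply: ired_parp.
exact: ired_struct (ncong_sym (prodF I P J R)) r (prodF I' P' J' R').
Qed.

(** The redexes to which the reduction axioms apply literally, with no parallel context. *)
Definition core_act (l : @plabel S) P P' : Prop :=
  head_act l P P' \/
  l = PTau /\ exists c v A B C D, [/\ rng c = RLocal,
    P = Par (Timeout (Out c (TVal v)) A B) (Timeout (In c) C D)
    & P' = Par A (vsubst v C)].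

Lemma pcong_par_exchange P Q R T :
  pcong (Par (Par P Q) (Par R T)) (Par (Par P R) (Par Q T)).
Proof.
apply: pcong_trans (pcong_parA _ _ _) _.
apply: pcong_trans (pcong_sym (pcong_parA _ _ _)).
apply: pcong_par (pcong_refl _) _.
apply: pcong_trans (pcong_sym (pcong_parA _ _ _)) _.
apply: pcong_trans (pcong_parA _ _ _).
exact: pcong_par (pcong_parC _ _) (pcong_refl _).
Qed.

Lemma pcong_parCA P Q R : pcong (Par Q (Par P R)) (Par P (Par Q R)).
Proof.
apply: pcong_trans (pcong_sym (pcong_parA _ _ _)) _.
apply: pcong_trans (pcong_parA _ _ _).
exact: pcong_par (pcong_parC _ _) (pcong_refl _).
Qed.

(** A derivation singles out one prefix, or two for a local communication. Guards and recursions
    above it are resolved by congruence, and the untouched components are gathered in the rest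
    [R]. *)
Lemma act_core l P P' : act l P P' -> exists A A' R,
  [/\ core_act l A A', pcong P (Par A R) & pcong P' (Par A' R)].
Proof.
elim=> {l P P'}.
- move=> l P P' h; exists P, P', (@Nil S); split; first by left.
    exact/pcong_sym/pcong_par0.
  exact/pcong_sym/pcong_par0.
- move=> l1 l2 P P' Q Q' s _ [A [A' [R [cA eP eP']]]] _ [B [B' [T [cB eQ
    eQ']]]].
  (* Synchronising labels are never [PTau], so both cores are single prefixes. *)
  have hA : head_act l1 A A' by case: cA => // -[E]; rewrite E in s.
  have hB : head_act l2 B B' by case: cB => // -[E]; move: (psyncC s);
    rewrite E.
  have e : pcong (Par P Q) (Par (Par A B) (Par R T)).
    by apply: pcong_trans (pcong_par_exchange _ _ _ _); apply: pcong_par.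
  have e' : pcong (Par P' Q') (Par (Par A' B') (Par R T)).
    by apply: pcong_trans (pcong_par_exchange _ _ _ _); apply: pcong_par.
  case: hA s e e' => [c v A1 A2|c v A1 A2|? ? ?|? ? ?|? ?] s;
    case: hB s => [c' v' B1 B2|c' v' B1 B2|? ? ?|? ? ?|? ?] //= [<- <- rc] e e'.
    exists (Par (Timeout (Out c (TVal v)) A1 A2) (Timeout (In c) B1 B2)).
    exists (Par A1 (vsubst v B1)), (Par R T); split=> //; right; split=> //.
    by exists c, v, A1, A2, B1, B2.
  (* Here the receiver is on the left, while the axiom expects the sender there; commutativity
     exchanges them. *)
  exists (Par (Timeout (Out c (TVal v)) B1 B2) (Timeout (In c) A1 A2)).
  exists (Par B1 (vsubst v A1)), (Par R T); split.
  + by right; split=> //; exists c, v, B1, B2, A1, A2.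
  + by apply: pcong_trans e _; apply: pcong_par (pcong_parC _ _) (pcong_refl _).
  + by apply: pcong_trans e' _;
      apply: pcong_par (pcong_parC _ _) (pcong_refl _).
- move=> l P P' Q _ [A [A' [R [c e e']]]]; exists A, A', (Par R Q); split=> //.
    by apply: pcong_trans (pcong_parA _ _ _); apply: pcong_par (pcong_refl _).
  by apply: pcong_trans (pcong_parA _ _ _); apply: pcong_par (pcong_refl _).
- move=> l P P' Q _ [A [A' [R [c e e']]]]; exists A, A', (Par Q R); split=> //.
    by apply: pcong_trans (pcong_parCA _ _ _);
      apply: pcong_par (pcong_refl _) _.
  by apply: pcong_trans (pcong_parCA _ _ _); apply: pcong_par (pcong_refl _) _.
- move=> l P Q _ [A [A' [R [c e e']]]]; exists A, A', R; split=> //.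
  exact: pcong_trans (pcong_unfold _) e.
- move=> l b r P Q P' g _ [A [A' [R [c e e']]]]; exists A, A', R; split=> //.
  exact: pcong_trans (pcong_ite_pick _ _ g) e.
Qed.

Lemma core_ired l w n I I' A A' mu h : core_act l A A' ->
  node_label h I l (NInst w) I' ->
  ired w (Node n I A mu h) (Node n I' A' mu h).
Proof.
case=> [hA|[-> [c [v [B [C [D [T [rc -> ->]]]]]]]]] hl.
  move E: (NInst w) hl => u hl; case: hl E hA.
  - move=> [->]; move E: (PPos h) => l' hA; case: hA E => // k P [<-].
    exact: ired_pos.
  - move=> s v e [->]; move E: (PRead s v) => l' hA;
      case: hA E => // s' v' P [<- <-].
    exact: ired_sensread.
  - move=> a v e [->]; move E: (PWrite a v) => l' hA;
      case: hA E => // a' v' P [<- <-].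
    exact: ired_actunchg.
  - move=> a v e [->]; move E: (PWrite a v) => l' hA;
      case: hA E => // a' v' P [<- <-].
    exact: ired_actchg.
  - by move=> [->]; move E: (@PTau S) => l' hA; case: hA E.
  - by [].
  - by [].
move: hl; move E: (@PTau S) => l' hl.
move E': (NInst w) hl => u hl; case: hl E E' => // _ [->].
exact: ired_loccom.
Qed.

Lemma ncong_extrude c d M N : rng d = rng c -> d \notin free_chans M ->
  d \notin free_chans N ->
  ncong (NPar (Res c M) N) (Res d (NPar (swap_net c d M) N)).
Proof.
move=> E dM dN; apply: ncong_trans (ncong_parC _ _) _.
apply: ncong_trans (ncong_par (ncong_refl _) (ncong_alpha dM E)) _.
apply: ncong_trans (ncong_sym (ncong_extr _ dN)) _.
exact/ncong_res/ncong_parC.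
Qed.

Fixpoint net_size M : nat :=
  match M with
  | Zero | Node _ _ _ _ _ => 1
  | NPar M N => (net_size M + net_size N).+1
  | Res _ M => (net_size M).+1
  end.

Lemma net_size_swap c d M : net_size (swap_net c d M) = net_size M.
Proof. by elim: M => //= [M -> N ->|e M ->]. Qed.

(** A fresh channel with the range of [c] renames the restriction apart. It is fresh for the
    residuals too, since steps create no free channel, so the same extrusion is undone after the
    reduction. *)
Lemma ired_extrude w c M M' N N' l l' :
  itr l M M' -> itr l' N N' -> nlabel_chan l <> Some c ->
  (forall d, nlabel_chan l <> Some d -> rng d = rng c ->
     itr l (swap_net c d M) (swap_net c d M') ->
     ired w (NPar (swap_net c d M) N) (NPar (swap_net c d M') N')) ->
  ired w (NPar (Res c M) N) (NPar (Res c M') N').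
Proof.
move=> hM hN nc H; have [d []] := chan_fresh c (free_chans M ++ free_chans N).
rewrite mem_cat negb_or => /andP[dM dN] E.
have dM' : d \notin free_chans M' by apply: contraNN dM;
  apply: itr_free_chans hM _.
have dN' : d \notin free_chans N' by apply: contraNN dN;
  apply: itr_free_chans hN _.
have nd : nlabel_chan l <> Some d by move=> /(itr_label_chan hM); apply/negP.
apply: ired_struct (ncong_extrude E dM dN) _ (ncong_sym (ncong_extrude E dM'
  dN')).
apply: ired_res; apply: H => //.
by rewrite -{1}(swap_nlabel_fresh nc nd); apply: itr_swap.
Qed.

Lemma ncong_parAC M N O : ncong (NPar (NPar M N) O) (NPar (NPar M O) N).
Proof.
apply: ncong_trans (ncong_parA _ _ _) _.
apply: ncong_trans (ncong_sym (ncong_parA _ _ _)).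
exact: ncong_par (ncong_refl _) (ncong_parC _ _).
Qed.

Lemma ired_parC w M N M' N' : ired w (NPar M N) (NPar M' N') ->
  ired w (NPar N M) (NPar N' M').
Proof. by move=> h; apply: ired_struct (ncong_parC _ _) h (ncong_parC _ _). Qed.

Lemma ired_parAC w M M' N N' O : ired w (NPar M N) (NPar M' N') ->
  ired w (NPar (NPar M O) N) (NPar (NPar M' O) N').
Proof.
move=> h; apply: ired_struct (ncong_parAC _ _ _) _ (ncong_parAC _ _ _).
exact: ired_parn.
Qed.

Lemma ired_parCAC w M M' N N' O : ired w (NPar M N) (NPar M' N') ->
  ired w (NPar (NPar O M) N) (NPar (NPar O M') N').
Proof.
move=> /ired_parAC h; apply: ired_struct _ (h O) _.
  exact: ncong_par (ncong_parC _ _) (ncong_refl _).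
exact: ncong_par (ncong_parC _ _) (ncong_refl _).
Qed.

Lemma com_node_ired c v h k n I P mu m J Q nu M' N' :
  itr (NOut c v k) (Node n I P mu k) M' -> itr (NIn c v h) (Node m J Q nu h)
    N' ->
  le_range (dist h k) (rng c) ->
  ired (@Tau S) (NPar (Node n I P mu k) (Node m J Q nu h)) (NPar M' N').
Proof.
move=> /itr_inv [pl [I' [P' [hl hP ->]]]] /itr_inv [pl' [J' [Q' [hl' hQ ->]]]]
  d.
have [EI El] : I' = I /\ pl = POut c v.
  by move E: (NOut c v k) hl => u hl; case: hl E => // c' v' _ [-> ->].
have [EJ El'] : J' = J /\ pl' = PIn c v.
  by move E: (NIn c v h) hl' => u hl'; case: hl' E => // c' v' _ [-> ->].
subst=> {hl hl'}.
have [A [A' [R [[hA|[//]] eP eP']]]] := act_core hP.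
have [B [B' [T [[hB|[//]] eQ eQ']]]] := act_core hQ.
apply: (@ired_struct _ _ _
  (NPar (Node n I (Par A R) mu k) (Node m J (Par B T) nu h))
  (NPar (Node n I (Par A' R) mu k) (Node m J (Par B' T) nu h))).
- by apply: ncong_par; apply: ncong_node.
- apply: ired_add2; move: hA hB d {hP hQ eP eP' eQ eQ'}.
  move E: (POut c v) => l hA; case: hA E => // c1 v1 A1 A2 [<- <-].
  move E: (PIn c v) => l' hB; case: hB E => // c2 v2 B1 B2 [<- <-] d.
  by apply: ired_glbcom; rewrite dist_sym.
- by apply: ncong_par; apply: ncong_node; apply: pcong_sym.
Qed.

(* Restrictions met on the way are renamed apart before being extruded, whence
   the induction on sizes. *)
Lemma com_ired c v h k M M' N N' :
  itr (NOut c v k) M M' -> itr (NIn c v h) N N' -> le_range (dist h k) (rng c)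
    ->
  ired (@Tau S) (NPar M N) (NPar M' N').
Proof.
move=> hM hN d;
  move: {2}(net_size M + net_size N) (leqnn (net_size M + net_size N)) => s.
elim: s M M' N N' hM hN => [|s IH] M M' N N' hM hN; first by case: M hM.
case: M hM => [|n J P mu h1|M1 M2|e M] hM sz.
- by case: (itr_inv hM).
- case: N hN sz => [|m J' Q nu h2|N1 N2|e N] hN sz.
  + by case: (itr_inv hN).
  + have Ek : h1 = k.
      have [pl [I' [P' [hl _ _]]]] := itr_inv hM.
      by move E: (NOut c v k) hl => u hl; case: hl E => // c' v' _ [_ _ ->].
    have Eh : h2 = h.
      have [pl [I' [P' [hl _ _]]]] := itr_inv hN.
      by move E: (NIn c v h) hl => u hl; case: hl E => // c' v' _ [_ _ ->].
    by subst; apply: com_node_ired hM hN d.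
  + apply: ired_parC; case/itr_inv: (hN) => [[N3 h3 ->]|[N3 h3 ->]|[//]].
      apply: ired_parAC; apply: ired_parC; apply: (IH _ _ _ _ hM h3).
      by move: sz => /=; rewrite !add1n !ltnS; apply: leq_trans;
        apply: leq_addr.
    apply: ired_parCAC; apply: ired_parC; apply: (IH _ _ _ _ hM h3).
    by move: sz => /=; rewrite !add1n !ltnS; apply: leq_trans; apply: leq_addl.
  + have [N3 [h3 nc ->]] := itr_inv hN.
    apply: ired_parC; apply: (ired_extrude h3 hM nc) => e' _ _ h4.
    by apply: ired_parC; apply: (IH _ _ _ _ hM h4); rewrite net_size_swap.
- case/itr_inv: (hM) => [[M3 h3 ->]|[M3 h3 ->]|[//]].
    apply: ired_parAC; apply: (IH _ _ _ _ h3 hN).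
    by move: sz => /=; rewrite addSn ltnS; apply: leq_trans;
      rewrite leq_add2r leq_addr.
  apply: ired_parCAC; apply: (IH _ _ _ _ h3 hN).
  by move: sz => /=; rewrite addSn ltnS; apply: leq_trans;
    rewrite leq_add2r leq_addl.
- have [M3 [h3 nc ->]] := itr_inv hM.
  apply: (ired_extrude h3 hN nc) => e' _ _ h4.
  by apply: (IH _ _ _ _ h4 hN); rewrite net_size_swap.
Qed.

Lemma itr_ired w M M' : itr (NInst w) M M' -> ired w M M'.
Proof.
elim: M M' => [|n J P mu h|M IHM N IHN|c M IH] M' /itr_inv.
- by [].
- move=> [pl [J' [P' [hl /act_core [A [A' [R [cA e e']]]] ->]]]].
  apply: (@ired_struct _ _ _ (Node n J (Par A R) mu h) (Node n J' (Par A' R)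
    mu h)).
  + exact: ncong_node.
  + by apply: ired_add1; apply: core_ired cA hl.
  + exact/ncong_node/pcong_sym.
- case=> [[M1 /IHM h ->]|[N1 /IHN h ->]|].
  + exact: ired_parn.
  + by apply: ired_parC; apply: ired_parn.
  + move=> [[->] [l1 [l2 [M1 [N1 [s hM hN ->]]]]]].
    case: l1 l2 s hM hN => [u|c v k|c v k] [u'|c' v' k'|c' v' k'] //= [<- <-
      d] hM hN.
      exact: com_ired hM hN d.
    by apply: ired_parC; apply: com_ired hN hM d.
- by move=> [M1 [/IH h _ ->]]; apply: ired_res.
Qed.

Lemma red_stuck_still M : red_stuck M -> still M.
Proof. by move=> s [M' /itr_ired h]; apply: s; exists M'. Qed.

Lemma ptick_prod (X : Type) (s : seq X) (F G : X -> proc S) :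
  (forall x, ptick (F x) (G x)) -> quiet (\big[@Par S/@Nil S]_(x <- s) F x) ->
  ptick (\big[@Par S/@Nil S]_(x <- s) F x) (\big[@Par S/@Nil S]_(x <- s) G x).
Proof.
move=> FG; elim: s => [|x s IH]; first by rewrite !big_nil => _;
  apply: ptick_nil.
rewrite !big_cons => q; apply: tick_par => //; apply: IH; exact: quiet_parr q.
Qed.

Lemma pcong_prod_cat (X : Type) (s t : seq X) (F : X -> proc S) :
  pcong (\big[@Par S/@Nil S]_(x <- s ++ t) F x)
    (Par (\big[@Par S/@Nil S]_(x <- s) F x) (\big[@Par S/@Nil S]_(x <- t) F x)).
Proof.
elim: s => [|x s IH] /=.
  rewrite big_nil; apply: pcong_trans (pcong_parC _ _).
  exact/pcong_sym/pcong_par0.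
rewrite !big_cons; apply: pcong_trans (pcong_sym (pcong_parA _ _ _)).
exact: pcong_par (pcong_refl _) IH.
Qed.

(** The same families decompose source and target, which matches the form of (timestat) and
    (timemob): each timeout yields its alternative and each sleeping process its continuation. *)
Lemma ptick_canon P P' : ptick P P' ->
  exists (ts : seq (@cprefix S * proc S * proc S)) (rs : seq (proc S)),
  pcong P (Par (\big[@Par S/@Nil S]_(x <- ts) Timeout x.1.1 x.1.2 x.2)
               (\big[@Par S/@Nil S]_(r <- rs) Pre (@Sleep S) r)) /\
  pcong P' (Par (\big[@Par S/@Nil S]_(x <- ts) x.2)
                (\big[@Par S/@Nil S]_(r <- rs) r)).
Proof.
elim=> {P P'}.
- exists [::], [::]; rewrite !big_nil.
  by split; apply/pcong_sym/pcong_par0.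
- move=> P; exists [::], [:: P]; rewrite !big_cons !big_nil.
  by split; apply: pcong_trans (pcong_parC _ _);
    apply: pcong_trans (pcong_sym (pcong_par0 _)) _;
      apply: pcong_sym (pcong_par0 _).
- move=> p P Q; exists [:: (p, P, Q)], [::]; rewrite !big_cons !big_nil /=.
  by split; apply: pcong_trans (pcong_sym (pcong_par0 _)) _;
    apply: pcong_sym (pcong_par0 _).
- move=> P P' Q Q' _ [ts [rs [e1 e2]]] _ [ts' [rs' [e3 e4]]] _.
  have cat (s s' : seq (@cprefix S * proc S * proc S)) (t t' : seq (proc S)) F
    G A B :
      pcong A (Par (\big[@Par S/@Nil S]_(x <- s) F x) (\big[@Par S/@Nil S]_(x
        <- t) G x)) ->
      pcong B (Par (\big[@Par S/@Nil S]_(x <- s') F x) (\big[@Par S/@Nil S]_(x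
        <- t') G x)) ->
      pcong (Par A B) (Par (\big[@Par S/@Nil S]_(x <- s ++ s') F x)
                           (\big[@Par S/@Nil S]_(x <- t ++ t') G x)).
    move=> eA eB; apply: pcong_trans (pcong_par eA eB) _.
    apply: pcong_trans (pcong_par_exchange _ _ _ _) _.
    by apply: pcong_par; apply/pcong_sym/pcong_prod_cat.
  by exists (ts ++ ts'), (rs ++ rs'); split; apply: cat.
- move=> P Q _ [ts [rs [e1 e2]]]; exists ts, rs; split=> //.
  exact: pcong_trans (pcong_unfold _) e1.
- move=> b P Q P' g _ [ts [rs [e1 e2]]]; exists ts, rs; split=> //.
  exact: pcong_trans (pcong_true _ _ g) e1.
- move=> b P Q P' g _ [ts [rs [e1 e2]]]; exists ts, rs; split=> //.
  exact: pcong_trans (pcong_false _ _ g) e1.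
Qed.

(** The timed reduction rules require the absence of reductions. It follows from the absence of
    transitions by [ired_itr], whence the distinct names. *)
Lemma ttrans_tred M M' : uniq (node_names M) -> ttrans M M' -> tred M M'.
Proof.
elim: M M' => [|n J P mu h|M IHM N IHN|c M IH] M' /= uM hM.
- by rewrite (ttrans_inv hM); apply: tred_timezero.
- have [P' [k [/ptick_canon [ts [rs [e e']]] s m ->]]] := ttrans_inv hM.
  apply: tred_struct (ncong_node _ _ _ _ e) _ (ncong_node _ _ _ _ (pcong_sym
    e')).
  have {s} := still_ncong (ncong_node _ _ _ _ e) s.
  move=> /(still_red_stuck (M := Node _ _ _ _ _) isT).
  (* Products over sequences become products over ordinals, as in the timed rules. *)
  rewrite !(big_tnth _ _ ts) !(big_tnth _ _ rs).
  case: mu m {hM} => /= [->|d] s; first exact: tred_timestat.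
  exact: tred_timemob.
- have [M1 [N1 [h1 h2 s ->]]] := ttrans_inv hM.
  move: (uM); rewrite cat_uniq => /and3P[u1 _ u2].
  by apply: tred_timepar; [apply: IHM|apply: IHN|apply: still_red_stuck].
- by have [M1 h1 ->] := ttrans_inv hM; apply: tred_res; apply: IH.
Qed.

Lemma tred_ttrans M M' : tred M M' -> exists2 M'', ttrans M M'' & ncong M'' M'.
Proof.
have node n I h p q (pi : 'I_p -> @cprefix S) (P Q : 'I_p -> proc S)
    (R : 'I_q -> proc S) mu k :
    let A := Par (\big[@Par S/@Nil S]_(i < p) Timeout (pi i) (P i) (Q i))
                 (\big[@Par S/@Nil S]_(j < q) Pre (@Sleep S) (R j)) in
    red_stuck (Node n I A mu h) -> moves mu h k ->
    ttrans (Node n I A mu h) (Node n I (Par (\big[@Par S/@Nil S]_(i < p) Q i)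
                       (\big[@Par S/@Nil S]_(j < q) R j)) mu k).
  move=> A /red_stuck_still s m; apply: ttrans_node => //.
  (* A local communication would be a tau-transition of the node; quietness then descends to each
     factor of the product. *)
  have qA : quiet A.
    move=> [A' hA]; apply: s; exists (Node n I A' mu h).
    exact: itr_node (node_tau _ _) hA.
  apply: tick_par => //; apply: ptick_prod; try by constructor.
    exact: quiet_parl qA.
  exact: quiet_parr qA.
elim=> {M M'}.
- move=> n I h p q pi P Q R N s; eexists; last exact: ncong_refl.
  exact: node.
- move=> n I h k p q pi P Q R N s d; eexists; last exact: ncong_refl.
  exact: node.
- move=> M M' N N' _ [M'' hM e] _ [N'' hN e'] /red_stuck_still s.
  exists (NPar M'' N''); last exact: ncong_par.
  exact: ttrans_par.
- by exists (@Zero S); [apply: ttrans_timezero|apply: ncong_refl].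
- move=> c M N _ [M'' hM e]; exists (Res c M''); first exact: ttrans_res.
  exact: ncong_res.
- move=> M N N' M' e _ [N'' hN e''] e'.
  have [M'' hM e3] := (ncong_tsim e).2 _ hN.
  exists M'' => //; apply: ncong_trans (ncong_sym e3) _.
  exact: ncong_trans e'' e'.
Qed.

End Correspondence.

(** * Transitions preserve well-formedness of networks *)

Section Preservation.

Context {S : signature}.
Implicit Types (P Q R : proc S) (M N O : net S) (I J : iface S) (h k : loc S).

(** A node-by-node relation containing both kinds of steps. The domain of actuators is kept only
    under a condition, because an update could extend it if the written actuator were undefined;
    well-formedness of the source discharges this. *)
Inductive evolves : net S -> net S -> Prop :=
  | evolves_refl M : evolves M M
  | evolves_node n I P mu h I' P' h' :
      isens I' = isens I ->
      ((forall a, a \in actuators P -> iact I a <> None) ->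
       forall a, iact I' a = None <-> iact I a = None) ->
      (forall K, hereditary K -> K P -> K P') ->
      evolves (Node n I P mu h) (Node n I' P' mu h')
  | evolves_par M M' N N' : evolves M M' -> evolves N N' ->
      evolves (NPar M N) (NPar M' N')
  | evolves_res c M M' : evolves M M' -> evolves (Res c M) (Res c M').

Lemma itr_evolves l M M' : itr l M M' -> evolves M M'.
Proof.
elim=> {l M M'}; try by eauto using evolves.
move=> pl l n I I' P P' mu h hl hP; apply: evolves_node.
- by case: hl.
- case: hl hP => //= a v _ /act_write_actuator aP def b.
  case: eqP => [->|_] //; split=> // E.
  by case: (def a aP).
- by move=> K hK; apply: act_hereditary hP.
Qed.

Lemma ttrans_evolves M M' : ttrans M M' -> evolves M M'.
Proof.
elim: M M' => [|n J P mu h|M IHM N IHN|c M IH] M' /ttrans_inv.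
- by move=> ->; apply: evolves_refl.
- move=> [P' [k [hP _ _ ->]]]; apply: evolves_node => // K hK.
  exact: ptick_hereditary hP.
- by move=> [M1 [N1 [/IHM h1 /IHN h2 _ ->]]]; apply: evolves_par.
- by move=> [M1 /IH h1 ->]; apply: evolves_res.
Qed.

Lemma evolves_node_names M M' : evolves M M' -> node_names M' = node_names M.
Proof. by elim=> {M M'} //= > _ -> _ ->. Qed.

Lemma evolves_has_node M M' n I' P' mu h' : evolves M M' ->
  has_node n I' P' mu h' M' -> exists I P h,
  [/\ has_node n I P mu h M, isens I' = isens I,
      (forall a, a \in actuators P -> iact I a <> None) ->
        forall a, iact I' a = None <-> iact I a = None
    & forall K, hereditary K -> K P -> K P'].
Proof.
elim=> {M M'} /=.
- by move=> M hM; exists I', P', h'.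
- move=> m I P nu h J Q k e1 e2 e3 [<- <- <- <- _].
  by exists I, P, h.
- by move=> M M' N N' _ IHM _ IHN [/IHM|/IHN] [I [P [h [hM e1 e2 e3]]]];
    exists I, P, h; split; auto.
- by move=> c M M' _ IH /IH.
Qed.

Lemma evolves_network M M' : evolves M M' -> network M -> network M'.
Proof.
move=> e [nn na ns nr nw nst nc ng].
have E n I' P' mu h' : has_node n I' P' mu h' M' -> exists I P h,
    [/\ has_node n I P mu h M, isens I' = isens I,
      forall a, iact I' a = None <-> iact I a = None
    & forall K, hereditary K -> K P -> K P'].
  move=> /(evolves_has_node e) [I [P [h [hM e1 e2 e3]]]].
  by exists I, P, h; split=> //; apply: e2; apply: nw hM.
split.
- by rewrite (evolves_node_names e).
- move=> n I P mu h m J Q nu k /E [I0 [P0 [h0 [h1 _ e1 _]]]].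
  move=> /E [J0 [Q0 [k0 [h2 _ e2 _]]]] nm a.
  by case: (na _ _ _ _ _ _ _ _ _ _ h1 h2 nm a) => [/e1|/e2]; auto.
- move=> n I P mu h m J Q nu k /E [I0 [P0 [h0 [h1 -> _ _]]]].
  by move=> /E [J0 [Q0 [k0 [h2 -> _ _]]]]; apply: ns h1 h2.
- move=> n I P mu h /E [I0 [P0 [h0 [h1 -> _ e3]]]] s sP.
  by apply: (nr _ _ _ _ _ h1);
    (* The hereditary property chosen is inclusion in the sensors of the source process, so that
       definedness is inherited from the source node. *)
    apply: (e3 _ (sensors_hereditary (sensors P0))) sP.
- move=> n I P mu h /E [I0 [P0 [h0 [h1 _ e2 e3]]]] a aP /e2.
  by apply: (nw _ _ _ _ _ h1);
    apply: (e3 _ (actuators_hereditary (actuators P0))) aP.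
- by move=> n I P mu h /E [I0 [P0 [h0 [h1 -> _ _]]]]; apply: nst h1.
- move=> n I P mu h /E [I0 [P0 [h0 [/nc h1 _ _ e3]]]].
  exact: e3 closed_hereditary h1.
- move=> n I P mu h /E [I0 [P0 [h0 [/ng h1 _ _ e3]]]].
  exact: e3 wf_hereditary h1.
Qed.

End Preservation.

Theorem theorem1 (S : signature) (M M' : net S) (w : label S) :
  network M -> network M' ->
  (trans w M M' -> red w M M') /\
  (red w M M' ->
     exists M'' : net S, network M'' /\ trans w M M'' /\ ncong M'' M').
Proof.
move=> nM _; have uM := network_names nM; case: w => [u|] /=; split.
- by move=> /itrP; apply: itr_ired.
- move=> /(ired_itr uM) [M'' h e]; exists M''; split; last by split=> //;
    apply/itrP.
  exact: evolves_network (itr_evolves h) nM.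
- exact: ttrans_tred.
- move=> /tred_ttrans [M'' h e]; exists M''; split=> //.
  exact: evolves_network (ttrans_evolves h) nM.
Qed.
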